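(* Let $R$ be a finite (commutative) local ring, let $k\ge 1$, and let $\xi_1,\dots,\xi_k$ be probability distributions on $R$ such that, for each $i$, the support of $\xi_i$ (a) contains two elements that differ by a unit of $R$, and (b) is not contained in an affine translate of a proper subring of $R$. For each $N\ge 1$, let $\mathcal{M}_1,\dots,\mathcal{M}_k$ be independent random $N\times N$ matrices over $R$, where the entries of $\mathcal{M}_i$ are independent and each have distribution $\xi_i$; let $\mathcal{G}$ be a Haar (uniformly) random element of $GL_N(R)$ independent of the $\mathcal{M}_i$; and let $\mathcal{U}_1,\dots,\mathcal{U}_k$ be independent, uniformly random $N\times N$ matrices over $R$. Then $$\mathcal{M}_1\mathcal{M}_2\cdots\mathcal{M}_k\,\mathcal{G}\;\sim\;\mathcal{U}_1\mathcal{U}_2\cdots\mathcal{U}_k ,$$ that is, there exist constants $c>0$ and $K>0$, not depending on $N$, such that for all $N\ge 1$ $$d_{TV}\big(\mathcal{M}_1\mathcal{M}_2\cdots\mathcal{M}_k\,\mathcal{G},\ \mathcal{U}_1\mathcal{U}_2\cdots\mathcal{U}_k\big)\le K e^{-cN}.$$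
   Context: $d_{TV}(X,Y)$ denotes the total variation distance between the distributions of the random variables $X$ and $Y$. An affine translate of a subring $S\subset R$ is a set of the form $\{us+b : s\in S\}$ with $u,b\in R$; subrings contain $1$. *)

(* Defs.v *)
From HB Require Import structures.
From mathcomp Require Import all_boot all_order all_algebra.
From mathcomp Require Import reals sequences exp.

Set Implicit Arguments.
Unset Strict Implicit.
Unset Printing Implicit Defensive.

Import Order.TTheory GRing.Theory Num.Theory.
Local Open Scope ring_scope.

(* [idealr_closed] includes [1 \notin I], so the ideals below are proper. *)
Definition maximal_ideal (R : finComUnitRingType) (m : {set R}) : Prop :=
  idealr_closed m /\
  forall I : {set R}, idealr_closed I -> m \subset I -> I = m.

Definition local_ring (R : finComUnitRingType) : Prop :=
  exists! m : {set R}, maximal_ideal m.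

Definition affine_translate (R : finComUnitRingType) (S : {set R}) (u b : R) :
  {set R} := [set u * s + b | s in S].

Record fdist (K : realType) (T : finType) := FDist {
  fdist_fun :> {ffun T -> K};
  fdist_ge0 : forall x, 0 <= fdist_fun x;
  fdist_sum1 : \sum_x fdist_fun x = 1 }.

Section FiniteDistributions.
Variable K : realType.
Implicit Types T U I : finType.

Definition fsupp T (P : fdist K T) : {set T} := [set x | P x != 0].

Definition Pr T (P : fdist K T) (E : {set T}) : K := \sum_(x in E) P x.

Definition dTV T (P Q : fdist K T) : K :=
  \big[Num.max/0]_(E : {set T}) `|Pr P E - Pr Q E|.

Section Uniform.
Variables (T : finType) (A : {set T}) (A_gt0 : (0 < #|A|)%N).

Definition unif_fun : {ffun T -> K} := [ffun x => (x \in A)%:R / #|A|%:R].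

Lemma unif_ge0 x : 0 <= unif_fun x.
Proof. by rewrite ffunE divr_ge0. Qed.

Lemma unif_sum1 : \sum_x unif_fun x = 1.
Proof.
under eq_bigr do rewrite ffunE.
rewrite -mulr_suml -natr_sum -big_mkcond /= sum1_card divff //.
by rewrite pnatr_eq0 -lt0n.
Qed.

Definition fdist_unif : fdist K T := FDist unif_ge0 unif_sum1.
End Uniform.

(* Law of [f X] where [X] has law [P]. *)
Section Map.
Variables (T U : finType) (f : T -> U) (P : fdist K T).

Definition map_fun : {ffun U -> K} := [ffun y => \sum_(x | f x == y) P x].

Lemma map_ge0 y : 0 <= map_fun y.
Proof. by rewrite ffunE sumr_ge0 // => x _; exact: fdist_ge0. Qed.

Lemma map_sum1 : \sum_y map_fun y = 1.
Proof.
under eq_bigr do rewrite ffunE.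
rewrite -(fdist_sum1 P) [RHS](partition_big f xpredT) //=.
Qed.

Definition fdist_map : fdist K U := FDist map_ge0 map_sum1.
End Map.

(* Joint law of independent variables, the [i]-th of which has law [P i]. *)
Section Prod.
Variables (I T : finType) (P : I -> fdist K T).

Definition prod_fun : {ffun {ffun I -> T} -> K} :=
  [ffun x : {ffun I -> T} => \prod_i P i (x i)].

Lemma prod_ge0 x : 0 <= prod_fun x.
Proof. by rewrite ffunE prodr_ge0 // => i _; exact: fdist_ge0. Qed.

Lemma prod_sum1 : \sum_x prod_fun x = 1.
Proof.
under eq_bigr do rewrite ffunE.
rewrite -(bigA_distr_bigA (fun i x => P i x)) big1 // => i _.
exact: fdist_sum1.
Qed.

Definition fdist_prod : fdist K {ffun I -> T} := FDist prod_ge0 prod_sum1.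
End Prod.

(* Joint law of an independent pair. *)
Section Pair.
Variables (T U : finType) (P : fdist K T) (Q : fdist K U).

Definition pair_fun : {ffun T * U -> K} := [ffun x => P x.1 * Q x.2].

Lemma pair_ge0 x : 0 <= pair_fun x.
Proof. by rewrite ffunE mulr_ge0 // fdist_ge0. Qed.

Lemma pair_sum1 : \sum_x pair_fun x = 1.
Proof.
under eq_bigr do rewrite ffunE.
rewrite -(pair_bigA _ (fun x y => P x * Q y)) /=.
under eq_bigr do rewrite -mulr_sumr fdist_sum1 mulr1.
exact: fdist_sum1.
Qed.

Definition fdist_pair : fdist K (T * U)%type := FDist pair_ge0 pair_sum1.
End Pair.

Section RandomMatrices.
Variables (R : finComUnitRingType) (N : nat).

Definition iid_matrix (xi : fdist K R) : fdist K 'M[R]_N :=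
  fdist_map (fun x : {ffun 'I_N * 'I_N -> R} => \matrix_(i, j) x (i, j))
    (fdist_prod (fun _ : 'I_N * 'I_N => xi)).

Lemma card_matrices_gt0 : (0 < #|[set: 'M[R]_N]|)%N.
Proof. by apply/card_gt0P; exists 0; rewrite inE. Qed.

Definition uniform_matrix : fdist K 'M[R]_N := fdist_unif card_matrices_gt0.

(* [{'GL_N[R]}] lives in dimension [N.-1.+1]; here [GL_N(R)] is the set of
   invertible matrices in ['M_N] itself. *)
Lemma card_GL_gt0 : (0 < #|[set g : 'M[R]_N | g \in unitmx]|)%N.
Proof. by apply/card_gt0P; exists 1%:M; rewrite inE unitmx1. Qed.

Definition haar_GL : fdist K 'M[R]_N := fdist_unif card_GL_gt0.

Definition law_MG (k : nat) (xi : 'I_k -> fdist K R) : fdist K 'M[R]_N :=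
  fdist_map (fun x : {ffun 'I_k -> 'M[R]_N} * 'M[R]_N =>
               (\prod_(i < k) x.1 i) *m x.2)
    (fdist_pair (fdist_prod (fun i => iid_matrix (xi i))) haar_GL).

Definition law_U (k : nat) : fdist K 'M[R]_N :=
  fdist_map (fun x : {ffun 'I_k -> 'M[R]_N} => \prod_(i < k) x i)
    (fdist_prod (fun _ : 'I_k => uniform_matrix)).

End RandomMatrices.
End FiniteDistributions.

Arguments haar_GL K R N : clear implicits.
Arguments uniform_matrix K R N : clear implicits.
Arguments law_U K R N k : clear implicits.

(* Main.v *)
Require Import Defs.
From mathcomp Require Import all_boot all_order all_algebra.
From mathcomp Require Import all_fingroup all_solvable all_field all_character.
From mathcomp Require Import reals sequences exp.
From mathcomp Require Import complex ring lra.

(** The heart is one factor [M] with i.i.d. entries: [M G] is close to uniform.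
    Averaging the test function over [G] makes it invariant under column
    operations. Replace the columns of [M] by uniform ones one at a time. When
    column [c] is exchanged, invariance allows one to add to it a random
    combination of the other columns, so that by Parseval on [R^N] the error is
    governed by
      [sum_(w <> 0) prod_a |xi^(w_a)|^2 * Pr(w kills all the other columns)],
    where [w] runs over [N]-tuples of additive characters of [R].  Expanding the
    probability turns this into an average over words [r] in [R^(N-1)] of
    [(sum_chi |xi^(chi)|^2 prod_j |xi^(r_j chi)|)^N - 1]. For a word whose
    frequent letters form the set [T], the inner sum is essentially the mass of
    the characters killing [T * (supp xi - supp xi)]. It is [1] when [T = R];
    otherwise it is less than [|R| / |T|], because in the equality case [T] is
    an additive subgroup containing 1 whose ring of multipliers contains
    [(supp xi - supp xi) / u] for a unit [u], hence is [R] by hypothesis (b).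
    As the proportion of words with frequent letters [T] is
    roughly [(|T| / |R|)^(N-1)], the total is exponentially small. *)

Set Implicit Arguments.
Unset Strict Implicit.
Unset Printing Implicit Defensive.

Import Order.TTheory GRing.Theory Num.Theory.
Local Open Scope ring_scope.

(** * Elementary inequalities *)

Section Geometric.
Variable K : realType.
Implicit Types x y e : K.

Lemma bernoulli x n : -1 <= x -> 1 + n%:R * x <= (1 + x) ^+ n.
Proof.
move=> x_ge; elim: n => [|n IHn]; first by rewrite mul0r addr0 expr0.
rewrite exprS; apply: le_trans (ler_wpM2l _ IHn); last by rewrite -lerBlDl sub0r.
have : 0 <= n%:R * x ^+ 2 by rewrite mulr_ge0 ?sqr_ge0.
by rewrite -natr1; nra.
Qed.

Lemma expr_small x e : 0 < x < 1 -> 0 < e -> exists2 m, (0 < m)%N & x ^+ m <= e.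
Proof.
move=> /andP[x0 x1] e0; pose d := x^-1 - 1.
have d0 : 0 < d by rewrite subr_gt0 invf_gt1.
have := archi_boundP (ltW (_ : 0 < (d * e)^-1)).
set m := Num.bound _ => hm.
have {}hm : (d * e)^-1 < m%:R by apply: hm; rewrite invr_gt0 mulr_gt0.
have m0 : (0 < m)%N by rewrite -(ltr0n K); apply: lt_trans hm; rewrite invr_gt0 mulr_gt0.
exists m => //; rewrite -[x]invrK exprVn -[e]invrK lef_pV2 ?posrE ?exprn_gt0 ?invr_gt0 //.
have -> : x^-1 = 1 + d by rewrite addrCA subrr addr0.
apply: le_trans (bernoulli m _); last by apply: le_trans (ltW d0); rewrite oppr_le0.
apply: le_trans (_ : m%:R * d <= _); last by rewrite lerDr.
by rewrite -ler_pdivrMr // mulrC -invfM ltW.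
Qed.

(** The linear factor is absorbed by enlarging the ratio. With [y = (1 + x) / 2] one has
    [x <= y ^+ 2], and [n.+1%:R * y ^+ n <= 1 + y + ... + y ^+ n <= (1 - y)^-1]. *)
Lemma linear_geometric x : 0 <= x < 1 -> exists y C,
  [/\ 0 < y < 1, 0 < C & forall n, n.+1%:R * x ^+ n <= C * y ^+ n].
Proof.
move=> /andP[x0 x1]; pose y := (1 + x) / 2.
have y0 : 0 < y by rewrite divr_gt0 // ltr_wpDr.
have y1 : y < 1 by rewrite ltr_pdivrMr // mul1r -[2]/(1 + 1) ltrD2l.
have xy : x <= y ^+ 2.
  rewrite -subr_ge0 (_ : _ - x = ((1 - x) / 2) ^+ 2) ?sqr_ge0 //.
  by rewrite /y; field.
exists y, (1 - y)^-1; split; rewrite ?y0 ?invr_gt0 ?subr_gt0 // => n.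
apply: le_trans (_ : n.+1%:R * y ^+ n * y ^+ n <= _).
  rewrite -mulrA ler_wpM2l // -exprD addnn -mul2n exprM lerXn2r ?nnegrE //.
  by rewrite sqr_ge0.
apply: ler_wpM2r; first by rewrite exprn_ge0 // ltW.
rewrite -[leRHS]mul1r ler_pdivlMr ?subr_gt0 //.
apply: le_trans (_ : (\sum_(i < n.+1) y ^+ i) * (1 - y) <= _).
  apply: ler_wpM2r; first by rewrite subr_ge0 ltW.
  rewrite mulr_natl -{1}(card_ord n.+1) -sumr_const; apply: ler_sum => i _.
  by rewrite ler_wiXn2l ?ltW // -ltnS.
by rewrite mulrC -opprB mulNr -subrX1 opprB gerBl exprn_ge0 // ltW.
Qed.

Lemma expR_sub1_le x : expR x - 1 <= x * expR x.
Proof.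
have := expR_ge1Dx (- x); rewrite -(ler_pM2r (expR_gt0 x)) -expRD addNr expR0.
by nra.
Qed.

End Geometric.

(** The difference of the two sides is the variance of [a] under the weights [p]. *)
Lemma jensen_sqr (K : realFieldType) (I : finType) (p a : I -> K) :
  (forall i, 0 <= p i) -> \sum_i p i = 1 ->
  (\sum_i p i * a i) ^+ 2 <= \sum_i p i * a i ^+ 2.
Proof.
move=> p0 p1; set A := \sum_i p i * a i.
have : 0 <= \sum_i p i * (a i - A) ^+ 2.
  by apply: sumr_ge0 => i _; rewrite mulr_ge0 ?sqr_ge0.
have -> : \sum_i p i * (a i - A) ^+ 2 = \sum_i p i * a i ^+ 2 - A ^+ 2.
  transitivity (\sum_i (p i * a i ^+ 2 - A *+ 2 * (p i * a i) + A ^+ 2 * p i)).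
    by apply: eq_bigr => i _; ring.
  by rewrite !big_split /= sumrN -!mulr_sumr p1 -/A; ring.
by rewrite subr_ge0.
Qed.

(** * Additive characters *)

Lemma prim_root_exists (C : numClosedFieldType) (n : nat) :
  (0 < n)%N -> exists z : C, n.-primitive_root z.
Proof.
move=> n_gt0; pose p : {poly C} := 'X^n - 1.
have [r Dp] := closed_field_poly_normal p.
rewrite (monicP _) ?monicXnsubC // scale1r in Dp.
have rn1 : all n.-unity_root r by apply/allP=> x; rewrite -root_prod_XsubC -Dp.
have sz_r : (n < (size r).+1)%N.
  by rewrite -(size_prod_XsubC r id) -Dp size_XnsubC.
have [|z] := hasP (has_prim_root n_gt0 rn1 _ sz_r); last by exists z.
by rewrite -separable_prod_XsubC -Dp separable_Xn_sub_1 // pnatr_eq0 -lt0n.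
Qed.

Section Dual.
Variables (C : numClosedFieldType) (R : finComUnitRingType) (z : C).
Hypothesis z_prim : #|R|.-primitive_root z.

(** A character of [(R, +)] is stored through its exponents with respect to [z]. All its values are
    [#|R|]-th roots of unity, so the characters form a [finType] over which one can sum. *)
Definition is_char (f : {ffun R -> 'I_#|R|}) : bool :=
  [forall x, forall y, z ^+ f (x + y) == z ^+ f x * z ^+ f y].

Definition dual : finType := {f : {ffun R -> 'I_#|R|} | is_char f}.

Definition ev (chi : dual) (x : R) : C := z ^+ val chi x.

Lemma evD (chi : dual) x y : ev chi (x + y) = ev chi x * ev chi y.
Proof. by have /forallP/(_ x)/forallP/(_ y)/eqP := valP chi. Qed.

Lemma norm_ev (chi : dual) x : `|ev chi x| = 1.
Proof.
have m_gt0 : (0 < #|R|)%N by apply/card_gt0P; exists 0.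
suff /eqP z1 : `|z| == 1 by rewrite normrX z1 expr1n.
by rewrite -(pexpr_eq1 m_gt0) // -normrX (prim_expr_order z_prim) normr1.
Qed.

Lemma ev_neq0 (chi : dual) x : ev chi x != 0.
Proof. by rewrite -normr_eq0 norm_ev oner_eq0. Qed.

Lemma ev0 (chi : dual) : ev chi 0 = 1.
Proof.
by apply: (mulfI (ev_neq0 chi 0)); rewrite -evD addr0 mulr1.
Qed.

Lemma evN (chi : dual) x : ev chi (- x) = (ev chi x)^-1.
Proof.
by apply: (mulfI (ev_neq0 chi x)); rewrite -evD subrr ev0 divff ?ev_neq0.
Qed.

Lemma ev_conj (chi : dual) x : (ev chi x)^* = ev chi (- x).
Proof. by rewrite evN invC_norm norm_ev expr1n invr1 mul1r. Qed.

Lemma ev_inj (chi psi : dual) : ev chi =1 ev psi -> chi = psi.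
Proof.
move=> e; apply/val_inj/ffunP => x; apply/val_inj/eqP => /=.
have := e x; rewrite /ev => /eqP; rewrite (eq_prim_root_expr z_prim).
by rewrite !modn_small.
Qed.

(** By Lagrange [x *+ #|R| = 0], so every value of [phi] is a [#|R|]-th root of unity, hence a power
    of [z]. *)
Lemma char_ex (phi : R -> C) :
  phi 0 = 1 -> (forall x y, phi (x + y) = phi x * phi y) ->
  exists chi : dual, ev chi =1 phi.
Proof.
move=> phi0 phiD.
have phiM n x : phi (x *+ n) = phi x ^+ n.
  by elim: n => [|n IHn]; rewrite ?mulr0n ?expr0 // mulrS exprS phiD IHn.
have root x : phi x ^+ #|R| = 1.
  rewrite -phiM -phi0; congr phi.
  have := @expg_cardG R [group of [set: R]] x (in_setT x).
  by rewrite FinRing.zmodXgE cardsT.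
pose f := [ffun x => sval (prim_rootP z_prim (root x))].
have fE x : z ^+ f x = phi x.
  by rewrite ffunE; case: (prim_rootP z_prim (root x)).
have f_char : is_char f by apply/'forall_'forall_eqP => x y; rewrite !fE.
by exists (Sub f f_char).
Qed.

(** The kernels of the irreducible characters of a finite group meet trivially, and for the abelian
    group [(R, +)] these characters are linear. *)
Lemma ev_sep (x : R) : x != 0 -> exists chi : dual, ev chi x != 1.
Proof.
move=> x0; have m_gt0 : (0 < #|R|)%N by apply/card_gt0P; exists 0.
have [w w_prim] := C_prim_root_exists m_gt0.
pose G := [group of [set: R]].
have abG : abelian G by apply/centsP => a _ b _; exact: addrC.
have [i xi_x] : exists i : Iirr G, 'chi_i x != 1.
  apply/existsP; apply: contraT => /existsPn h.
  suff: x \in \bigcap_(i : Iirr G) cfker 'chi[G]_i.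
    by rewrite TI_cfker_irr => /set1gP /eqP; rewrite (negPf x0).
  apply/bigcapP => i _; have lin : 'chi_i \is a linear_char by exact/char_abelianP.
  rewrite cfkerEchar ?irr_char // inE inE /= lin_char1 //.
  exact: negPn (h i).
have lin : 'chi_i \is a linear_char by exact/char_abelianP.
have chiD a b : 'chi_i (a + b) = 'chi_i a * 'chi_i b.
  by have := lin_charM lin (in_setT a) (in_setT b).
have root a : 'chi_i a ^+ #|R| = 1.
  by rewrite -lin_charX ?inE // -cardsT expg_cardG ?inE // lin_char1.
(* The irreducible characters take values in the algebraic numbers, not in [C]. Their exponents with
   respect to [w] are reused with [z]: both roots have order [#|R|], so the same congruences decide
   equality of powers. *)
pose k a := sval (prim_rootP w_prim (root a)).
have kE a : w ^+ k a = 'chi_i a by rewrite /k; case: (prim_rootP _ _).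
have [||chi chiE] := @char_ex (fun a => z ^+ k a).
- apply/eqP; rewrite -(expr0 z) (eq_prim_root_expr z_prim).
  by rewrite -(eq_prim_root_expr w_prim) kE expr0 (lin_char1 lin).
- move=> a b; apply/eqP; rewrite -exprD (eq_prim_root_expr z_prim).
  by rewrite -(eq_prim_root_expr w_prim) exprD !kE chiD.
exists chi; rewrite chiE; apply: contra xi_x.
by rewrite -(expr0 z) (eq_prim_root_expr z_prim) -(eq_prim_root_expr w_prim) kE.
Qed.

Lemma trivial_char_proof : is_char [ffun=> Ordinal (prim_order_gt0 z_prim)].
Proof. by apply/'forall_'forall_eqP => x y; rewrite !ffunE !expr0 mulr1. Qed.

Definition trivial_char : dual := Sub _ trivial_char_proof.

Lemma ev_trivial x : ev trivial_char x = 1.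
Proof. by rewrite /ev /= ffunE expr0. Qed.

Lemma ev_eq1 (chi : dual) : (forall x, ev chi x = 1) -> chi = trivial_char.
Proof. by move=> h; apply: ev_inj => x; rewrite ev_trivial h. Qed.

Lemma scale_char_proof (s : R) (chi : dual) :
  is_char [ffun x => val chi (s * x)].
Proof.
by apply/'forall_'forall_eqP => x y; rewrite !ffunE mulrDr; exact: (evD chi).
Qed.

Definition scale_char (s : R) (chi : dual) : dual := Sub _ (scale_char_proof s chi).

Lemma ev_scale s chi x : ev (scale_char s chi) x = ev chi (s * x).
Proof. by rewrite /ev /= ffunE. Qed.

(** If [x != 0], multiplication by a character [psi] with [ev psi x != 1] permutes the dual and
    multiplies the sum by [ev psi x], so the sum vanishes. *)
Lemma sum_ev_dual (x : R) :
  \sum_(chi : dual) ev chi x = if x == 0 then #|dual|%:R else 0.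
Proof.
case: eqVneq => [->|x0].
  by under eq_bigr do rewrite ev0; rewrite sumr_const.
have [psi psix] := ev_sep x0.
have /fin_all_exists[mul mulE] (chi : dual) :
    exists chi' : dual, ev chi' =1 (fun y => ev psi y * ev chi y).
  by apply: char_ex => [|a b]; rewrite ?ev0 ?mulr1 // !evD mulrACA.
have mul_inj : injective mul.
  move=> chi1 chi2 e; apply: ev_inj => y.
  by apply: (mulfI (ev_neq0 psi y)); rewrite -!mulE e.
set S := \sum_chi _; have : (ev psi x - 1) * S = 0.
  rewrite mulrBl mul1r mulr_sumr.
  under eq_bigr do rewrite -mulE.
  by rewrite [S](reindex_inj mul_inj) /= subrr.
by move=> /eqP; rewrite mulf_eq0 subr_eq0 (negPf psix) => /eqP.
Qed.

Lemma sum_ev_subgroup (B : {set R}) (chi : dual) : zmod_closed B ->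
  \sum_(b in B) ev chi b = if [forall b in B, ev chi b == 1] then #|B|%:R else 0.
Proof.
move=> [B0 BB]; case: ifPn => [/'forall_in_eqP h|].
  by rewrite (eq_bigr (fun=> 1)) // sumr_const.
move=> /forall_inPn[b0 b0B hb0].
have BD b : (b + b0 \in B) = (b \in B).
  apply/idP/idP => hb; first by rewrite -(addrK b0 b) BB.
  by rewrite -[b0]opprK BB // -sub0r BB.
set S := \sum_(b in B) _; have : (ev chi b0 - 1) * S = 0.
  rewrite mulrBl mul1r mulr_sumr.
  under eq_bigr do rewrite mulrC -evD.
  rewrite [S](reindex_inj (addIr b0)) /=.
  by under [X in _ - X]eq_bigl do rewrite BD; rewrite subrr.
by move=> /eqP; rewrite mulf_eq0 subr_eq0 (negPf hb0) => /eqP.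
Qed.

Lemma sum_ev_ring (chi : dual) :
  \sum_x ev chi x = if chi == trivial_char then #|R|%:R else 0.
Proof.
have := @sum_ev_subgroup [set: R] chi; rewrite cardsT.
under eq_bigl do rewrite inE; move=> ->; last by split=> [|x y]; rewrite !inE.
congr (if _ then _ else _); apply/forall_inP/eqP => [h|-> x _].
  by apply: ev_eq1 => x; apply/eqP/h; rewrite inE.
by rewrite ev_trivial.
Qed.

Lemma card_dual : #|dual| = #|R|.
Proof.
apply/eqP; rewrite -(eqr_nat C); apply/eqP.
transitivity (\sum_x \sum_(chi : dual) ev chi x).
  by under eq_bigr do rewrite sum_ev_dual; rewrite -big_mkcond big_pred1_eq.
rewrite exchange_big /=.
by under eq_bigr do rewrite sum_ev_ring; rewrite -big_mkcond big_pred1_eq.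
Qed.

Definition annihilator (B : {set R}) : {set dual} :=
  [set chi : dual | [forall b in B, ev chi b == 1]].

(** The sum of [ev chi b] over all [chi] and all [b] in [B] is computed in both orders: one keeps
    only the [chi] that annihilate [B], the other only [b = 0]. *)
Lemma card_annihilator (B : {set R}) : zmod_closed B ->
  (#|annihilator B| * #|B| = #|R|)%N.
Proof.
move=> B_zmod; apply/eqP; rewrite -(eqr_nat C); apply/eqP.
transitivity (\sum_(chi : dual) \sum_(b in B) ev chi b).
  under eq_bigr do rewrite sum_ev_subgroup //.
  by rewrite -big_mkcond sumr_const natrM mulr_natl cardsE.
rewrite exchange_big /=; under eq_bigr do rewrite sum_ev_dual card_dual.
rewrite -big_mkcondr (big_pred1 0) // => b /=.
by case: eqVneq => [->|]; rewrite ?andbF // (proj1 B_zmod).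
Qed.

(** * Fourier analysis on vectors over [R] *)

Section Vectors.
Variable N : nat.
Notation vec := {ffun 'I_N -> R}.
Implicit Types (w : {ffun 'I_N -> dual}) (x y : vec).

Definition trivial_word : {ffun 'I_N -> dual} := [ffun=> trivial_char].

Definition evw w x : C := \prod_a ev (w a) (x a).

Lemma evwD w x y : evw w (x + y) = evw w x * evw w y.
Proof.
by rewrite /evw -big_split; apply: eq_bigr => a _; rewrite ffunE evD.
Qed.

Lemma evw0 w : evw w 0 = 1.
Proof. by apply: big1 => a _; rewrite ffunE ev0. Qed.

Lemma evw_sum (I : Type) (r : seq I) (Q : pred I) (F : I -> vec) w :
  evw w (\sum_(i <- r | Q i) F i) = \prod_(i <- r | Q i) evw w (F i).
Proof. exact: (big_morph _ (evwD w) (evw0 w)). Qed.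

Lemma evw_conj w x : (evw w x)^* = evw w (- x).
Proof.
by rewrite rmorph_prod; apply: eq_bigr => a _; rewrite ffunE /= ev_conj.
Qed.

Lemma evw_trivial x : evw trivial_word x = 1.
Proof. by apply: big1 => a _; rewrite ffunE ev_trivial. Qed.

Lemma sum_evw x : \sum_w evw w x = if x == 0 then #|R|%:R ^+ N else 0.
Proof.
rewrite -(bigA_distr_bigA (fun a chi => ev chi (x a))).
case: eqVneq => [->|x0].
  under eq_bigr do rewrite ffunE sum_ev_dual eqxx card_dual.
  by rewrite prodr_const card_ord.
have [a xa] : exists a, x a != 0.
  apply/existsP; apply: contraNT x0 => /existsPn h.
  by apply/eqP/ffunP => a; rewrite ffunE; apply/eqP/negPn/h.
by rewrite (bigD1 a) //= sum_ev_dual (negPf xa) mul0r.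
Qed.

Lemma sum_evw_vec w :
  \sum_x evw w x = if w == trivial_word then #|R|%:R ^+ N else 0.
Proof.
rewrite -(bigA_distr_bigA (fun a s => ev (w a) s)).
case: eqVneq => [->|w0].
  under eq_bigr do rewrite ffunE sum_ev_ring eqxx.
  by rewrite prodr_const card_ord.
have [a wa] : exists a, w a != trivial_char.
  apply/existsP; apply: contraNT w0 => /existsPn h.
  by apply/eqP/ffunP => a; rewrite ffunE; apply/eqP/negPn/h.
by rewrite (bigD1 a) //= sum_ev_ring (negPf wa) mul0r.
Qed.

(** Once the square is expanded, summing over [w] first leaves only the diagonal terms. *)
Lemma parseval (F : vec -> C) :
  \sum_w `|\sum_x F x * evw w x| ^+ 2 = #|R|%:R ^+ N * \sum_x `|F x| ^+ 2.
Proof.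
transitivity (\sum_x \sum_y F x * (F y)^* * \sum_w evw w (x - y)).
  under eq_bigr => w _.
    rewrite normCK rmorph_sum mulr_suml.
    under eq_bigr => x _.
      rewrite mulr_sumr.
      under eq_bigr do rewrite rmorphM /= evw_conj mulrACA -evwD.
      over.
    over.
  rewrite exchange_big /=; apply: eq_bigr => x _.
  rewrite exchange_big /=; apply: eq_bigr => y _.
  by rewrite mulr_sumr.
rewrite mulr_sumr; apply: eq_bigr => x _.
rewrite (bigD1 x) //= subrr sum_evw eqxx mulrC -normCK.
rewrite big1 ?addr0 // => y yx.
by rewrite sum_evw subr_eq0 eq_sym (negPf yx) mulr0.
Qed.

Definition scalev (s : R) x : vec := [ffun a => s * x a].

Lemma evw_scale s w x :
  evw w (scalev s x) = evw [ffun a => scale_char s (w a)] x.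
Proof. by apply: eq_bigr => a _; rewrite !ffunE ev_scale. Qed.

Definition line_mean w x : C := #|R|%:R^-1 * \sum_s evw w (scalev s x).

(* [s |-> evw w (scalev s x)] is a character of [R], so its mean is 0 or 1. *)
Lemma line_mean_bool w x : exists b : bool, line_mean w x = b%:R.
Proof.
have [||chi chiE] := @char_ex (fun s => evw w (scalev s x)).
- by rewrite -[RHS](evw0 w); congr evw; apply/ffunP => a; rewrite !ffunE mul0r.
- move=> s t; rewrite -evwD; congr evw.
  by apply/ffunP => a; rewrite !ffunE mulrDl.
exists (chi == trivial_char); rewrite /line_mean -(eq_bigr _ (fun s _ => chiE s)).
rewrite sum_ev_ring; case: eqP => _; last by rewrite mulr0.
by rewrite mulVf // pnatr_eq0 -lt0n; apply/card_gt0P; exists 0.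
Qed.

End Vectors.

(** * Mass of annihilators and the spectral sum *)

Section Weight.
Variables (K : realType) (D : {set R}) (u : R) (rho : K).
Hypotheses (uD : u \in D) (u_unit : u \is a GRing.unit).
Hypothesis D_gen : forall S : {set R}, subring_closed S ->
  (forall d, d \in D -> exists2 s, s \in S & d = u * s) -> S = [set: R].
Hypotheses (rho_ge0 : 0 <= rho) (rho_lt1 : rho < 1).

(** A two-valued majorant for the modulus of the Fourier transform of an entry. In the application
    [D] is the set of differences of the support and [rho] the largest modulus at a character that
    is nontrivial on [D]. *)
Definition tau (chi : dual) : K := if chi \in annihilator D then 1 else rho.

Definition products (T : {set R}) : {set R} := [set t * d | t in T, d in D].

Definition mass (T : {set R}) : K :=
  \sum_(chi in annihilator (products T)) tau chi ^+ 2.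

Lemma tau_ge0 chi : 0 <= tau chi.
Proof. by rewrite /tau; case: ifP. Qed.

Lemma tau_le1 chi : tau chi <= 1.
Proof. by rewrite /tau; case: ifP => // _; exact: ltW. Qed.

Lemma trivial_annihilator B : trivial_char \in annihilator B.
Proof. by rewrite inE; apply/forall_inP => b _; rewrite ev_trivial. Qed.

Lemma tau_trivial : tau trivial_char = 1.
Proof. by rewrite /tau trivial_annihilator. Qed.

Lemma mass_ge1 T : 1 <= mass T.
Proof.
rewrite /mass (bigD1 trivial_char) ?trivial_annihilator //= tau_trivial expr1n.
by rewrite lerDl sumr_ge0 // => chi _; rewrite exprn_ge0 ?tau_ge0.
Qed.

Lemma mass_le_card T : mass T <= #|annihilator (products T)|%:R.
Proof.
rewrite -sumr_const; apply: ler_sum => chi _.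
by rewrite exprn_ile1 ?tau_ge0 ?tau_le1.
Qed.

Lemma mass_le T : mass T <= #|R|%:R.
Proof.
by apply: le_trans (mass_le_card T) _; rewrite ler_nat -card_dual max_card.
Qed.

Lemma mass_setT : mass [set: R] = 1.
Proof.
rewrite /mass (big_pred1 trivial_char) ?tau_trivial ?expr1n // => chi.
rewrite inE; apply/forall_inP/eqP => [h|-> x _]; last by rewrite ev_trivial.
apply: ev_eq1 => x; apply/eqP/h; apply/imset2P; exists (x / u) u => //.
by rewrite divrK.
Qed.

(** The bound [#|T| * mass T <= #|B| * #|A| = #|R|] comes from duality, where [A] annihilates
    [T * D] and [B] is the annihilator of [A]. Equality would need both [#|T| = #|B|] and
    [mass T = #|A|], which together force [T] to be the whole ring. *)
Lemma mass_lt (T : {set R}) : T != [set: R] -> #|T|%:R * mass T < #|R|%:R.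
Proof.
move=> TnR; pose A := annihilator (products T).
(* [B] is an additive subgroup that contains [T * D] and has the same annihilator [A]; this allows
   [card_annihilator] to be applied although [T * D] need not be a subgroup. *)
pose B := [set x : R | [forall chi in A, ev chi x == 1]].
have BP x : reflect (forall chi, chi \in A -> ev chi x = 1) (x \in B).
  by rewrite inE; exact: 'forall_in_eqP.
have B_zmod : zmod_closed B.
  split=> [|x y /BP hx /BP hy]; apply/BP => chi hA; rewrite ?ev0 //.
  by rewrite evD evN hx // hy // divr1.
have TDB t d : t \in T -> d \in D -> t * d \in B.
  move=> tT dD; apply/BP => chi; rewrite inE => /forall_inP h.
  by apply/eqP/h; apply/imset2P; exists t d.
have annB : annihilator B = A.
  apply/setP => chi; apply/idP/idP => [|hA].
    rewrite inE => /forall_inP h; rewrite inE.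
    by apply/forall_inP => _ /imset2P[t d tT dD ->]; exact/h/TDB.
  by rewrite inE; apply/forall_inP => x /BP hx; rewrite hx.
have cardAB := card_annihilator B_zmod; rewrite annB in cardAB.
have Tu_B : [set t * u | t in T] \subset B.
  by apply/subsetP => _ /imsetP[t tT ->]; exact: TDB.
have card_Tu : #|[set t * u | t in T]| = #|T| by rewrite card_imset //; exact: mulIr.
have TleB : (#|T| <= #|B|)%N by rewrite -card_Tu subset_leq_card.
have A_gt0 : (0 < #|A|)%N by apply/card_gt0P; exists trivial_char; exact: trivial_annihilator.
have B_gt0 : (0 < #|B|)%N by apply/card_gt0P; exists 0; exact: (proj1 B_zmod).
rewrite -cardAB mulnC natrM.
have [TltB|BleT] := ltnP #|T| #|B|.
  apply: le_lt_trans (_ : _ <= #|T|%:R * #|A|%:R) _.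
    by rewrite ler_wpM2l ?ler0n ?mass_le_card.
  by rewrite ltr_pM2r ?ltr0n // ltr_nat.
(* From here on [#|T| = #|B|], so [T] is the subgroup [B] divided by the unit [u], and is itself a
   subgroup. *)
have TuB : [set t * u | t in T] = B.
  by apply/eqP; rewrite eqEcard Tu_B card_Tu.
have memT t : (t \in T) = (t * u \in B).
  by rewrite -[in RHS]TuB (mem_imset _ t (mulIr u_unit)).
have Tsub : {in T &, forall x y, x - y \in T}.
  by move=> x y; rewrite !memT mulrBl; exact: (proj2 B_zmod).
have TeB : #|T| = #|B| by apply/eqP; rewrite eqn_leq TleB.
rewrite TeB ltr_pM2l ?ltr0n // lt_neqAle mass_le_card andbT.
apply: contra TnR => /eqP massE.
(* If the mass equals [#|A|], then every [chi] in [A] has [tau chi = 1]. As [rho < 1], it is trivial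
   on [D], in particular at [u]; hence [u \in B]. *)
have T1 : 1 \in T.
  rewrite memT mul1r; apply/BP => chi chiA.
  have : tau chi ^+ 2 = 1.
    apply/eqP; apply: contraT => chi_neq1.
    suff : mass T < #|A|%:R by rewrite massE ltxx.
    rewrite -sumr_const /mass -/A (bigD1 chi) //= [ltRHS](bigD1 chi) //=.
    apply: ltr_leD; first by rewrite lt_neqAle chi_neq1 exprn_ile1 ?tau_ge0 ?tau_le1.
    by apply: ler_sum => psi _; rewrite exprn_ile1 ?tau_ge0 ?tau_le1.
  rewrite /tau; case: ifP => [|_ /eqP].
    by rewrite inE => /forall_inP/(_ u uD)/eqP.
  by rewrite (pexpr_eq1 _ rho_ge0) // (lt_eqF rho_lt1).
(* The ring of multipliers of [T]. It contains [u^-1 * d] for each [d] in [D], because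
   [u^-1 * d * t * u = t * d] lies in [B]. So [S] is all of [R], and [1 \in T] gives [T = R]. *)
pose S := [set s : R | [forall t in T, s * t \in T]].
have SP s : reflect (forall t, t \in T -> s * t \in T) (s \in S).
  by rewrite inE; exact: forall_inP.
have ST : S = [set: R].
  apply: D_gen.
    split=> [|s s' /SP hs /SP hs'|s s' /SP hs /SP hs']; apply/SP => t tT.
    - by rewrite mul1r.
    - by rewrite mulrBl; apply: Tsub; [exact: hs|exact: hs'].
    - by rewrite -mulrA; exact/hs/hs'.
  move=> d dD; exists (u^-1 * d); last by rewrite mulVKr.
  by apply/SP => t tT; rewrite memT mulrAC [u^-1 * _]mulrC divrK // mulrC TDB.
apply/eqP/setP => s; rewrite inE -[s]mulr1.
by apply: (SP s _ _ T1); rewrite ST inE.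
Qed.

(** * Words, their frequent letters, and the decay of the spectral sum *)

Definition heavy (m n : nat) (r : {ffun 'I_n -> R}) : {set R} :=
  [set s | n <= m * #|[set j | r j == s]|]%N.

Definition twisted_mass (n : nat) (r : {ffun 'I_n -> R}) : K :=
  \sum_chi tau chi ^+ 2 * \prod_j tau (scale_char (r j) chi).

(** The characters that kill [heavy m r * D] contribute at most the mass. Any other [chi] is
    nontrivial at some [t * d] with [t] heavy, and each of the at least [n / m] occurrences of [t]
    in [r] contributes a factor [rho <= sigma ^+ m]. *)
Lemma twisted_mass_le (m n : nat) (sigma : K) (r : {ffun 'I_n -> R}) :
  0 <= sigma <= 1 -> rho <= sigma ^+ m ->
  twisted_mass r <= mass (heavy m r) + #|R|%:R * sigma ^+ n.
Proof.
move=> /andP[sigma_ge0 sigma_le1] rho_sigma.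
rewrite /twisted_mass (bigID (mem (annihilator (products (heavy m r))))) /=.
apply: lerD.
  apply: ler_sum => chi _; rewrite ler_piMr ?exprn_ge0 ?tau_ge0 //.
  by apply: prodr_ile1 => j _; rewrite tau_ge0 tau_le1.
apply: le_trans (_ : _ <= \sum_(chi : dual) sigma ^+ n) _; last first.
  by rewrite sumr_const card_dual mulr_natl.
rewrite big_mkcond; apply: ler_sum => chi _; case: ifPn; last by rewrite exprn_ge0.
rewrite inE => /forall_inPn[_ /imset2P[t d + dD ->] chi_td].
rewrite inE => t_heavy.
have taut j : r j == t -> tau (scale_char (r j) chi) = rho.
  move=> /eqP ->; rewrite /tau; case: ifP => //.
  by rewrite inE => /forall_inP/(_ d dD); rewrite ev_scale (negPf chi_td).
apply: le_trans (_ : _ <= rho ^+ #|[set j | r j == t]|) _.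
  apply: le_trans (_ : _ <= 1 * \prod_j tau (scale_char (r j) chi)) _.
    apply: ler_wpM2r; first by apply: prodr_ge0 => j _; exact: tau_ge0.
    by rewrite exprn_ile1 ?tau_ge0 ?tau_le1.
  rewrite mul1r (bigID (fun j => r j == t)) /=.
  rewrite (eq_bigr (fun=> rho)) // prodr_const cardsE ler_piMr ?exprn_ge0 //.
  by apply: prodr_ile1 => j _; rewrite tau_ge0 tau_le1.
apply: le_trans (_ : _ <= (sigma ^+ m) ^+ #|[set j | r j == t]|) _.
  by rewrite lerXn2r ?nnegrE ?exprn_ge0.
by rewrite -exprM ler_wiXn2l.
Qed.

(** Majorant of the squared error made when one of the [n.+1] columns is exchanged. The first factor
    bounds the squared Fourier coefficient of that column at [w]; the base of the power bounds the
    probability that [w] kills all multiples of a given other column. *)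
Definition spectral_sum (n : nat) : K :=
  \sum_(w : {ffun 'I_n.+1 -> dual} | w != trivial_word n.+1)
    (\prod_a tau (w a) ^+ 2)
    * (#|R|%:R^-1 * \sum_s \prod_a tau (scale_char s (w a))) ^+ n.

Lemma card_ring_gt0 : 0 < #|R|%:R :> K.
Proof. by rewrite ltr0n; apply/card_gt0P; exists 0. Qed.

Lemma scale_trivial s : scale_char s trivial_char = trivial_char.
Proof. by apply: ev_eq1 => x; rewrite ev_scale ev_trivial. Qed.

Lemma exprn_sum (n : nat) (f : R -> K) :
  (\sum_s f s) ^+ n = \sum_(r : {ffun 'I_n -> R}) \prod_j f (r j).
Proof.
by rewrite -[in LHS](card_ord n) -prodr_const bigA_distr_bigA.
Qed.

(** Expanding the power yields a sum over words [r] of length [n]. For fixed [r] the sum over all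
    [w] factors over the [n.+1] rows, and the trivial word accounts for the subtracted 1. *)
Lemma spectral_sumE n : spectral_sum n =
  #|R|%:R^-1 ^+ n * \sum_(r : {ffun 'I_n -> R}) (twisted_mass r ^+ n.+1 - 1).
Proof.
transitivity (\sum_(w : {ffun 'I_n.+1 -> dual} | w != trivial_word n.+1)
    \sum_(r : {ffun 'I_n -> R}) #|R|%:R^-1 ^+ n *
      \prod_a (tau (w a) ^+ 2 * \prod_j tau (scale_char (r j) (w a)))).
  apply: eq_bigr => w _; rewrite exprMn exprn_sum mulrCA !mulr_sumr.
  apply: eq_bigr => r _; rewrite [in RHS]big_split /=; congr (_ * (_ * _)).
  exact: exchange_big.
rewrite exchange_big mulr_sumr; apply: eq_bigr => r _ /=.
rewrite -mulr_sumr; congr (_ * _).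
rewrite -[n.+1 in RHS]card_ord -prodr_const bigA_distr_bigA /=.
rewrite [in RHS](bigD1 (trivial_word n.+1)) //=; set t := (X in _ = X + _ - _).
suff -> : t = 1 by rewrite addrC addrA addNr add0r.
rewrite /t; apply: big1 => a _.
rewrite ffunE tau_trivial expr1n mul1r; apply: big1 => j _.
by rewrite scale_trivial tau_trivial.
Qed.

Lemma twisted_mass_ge0 n (r : {ffun 'I_n -> R}) : 0 <= twisted_mass r.
Proof.
apply: sumr_ge0 => chi _; rewrite mulr_ge0 ?sqr_ge0 //.
by apply: prodr_ge0 => j _; exact: tau_ge0.
Qed.

(* Chernoff's trick: for [m] large, [y] can be small and [zz] close to 1, so
   that words with a given heavy set are few. *)
Lemma light_weight (m n : nat) (y zz : K) (r : {ffun 'I_n -> R}) :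
  (0 < m)%N -> 0 <= y <= 1 -> 0 <= zz -> zz ^+ m <= y ^+ #|R| ->
  zz ^+ n <= \prod_j (if r j \in heavy m r then 1 else y).
Proof.
move=> m_gt0 /andP[y0 y1] zz0 zzy; pose L := [set j | r j \notin heavy m r].
have LE j : (j \in L) = (r j \notin heavy m r) by rewrite in_set.
have -> : \prod_j (if r j \in heavy m r then 1 else y) = y ^+ #|L|.
  rewrite -prodr_const [RHS]big_mkcond; apply: eq_bigr => j _.
  by rewrite LE; case: (r j \in heavy m r).
rewrite -(@ler_pXn2r _ m) ?nnegrE ?exprn_ge0 // -!exprM [(n * m)%N]mulnC exprM.
apply: le_trans (_ : _ <= (y ^+ #|R|) ^+ n) _.
  by rewrite lerXn2r ?nnegrE ?exprn_ge0.
rewrite -exprM ler_wiXn2l //.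
(* What remains is [#|L| * m <= #|R| * n]: there are at most [#|R|] light letters, and each occurs
   fewer than [n / m] times. *)
rewrite -sum1_card (partition_big r xpredT) //= big_distrl /=.
rewrite -[#|R|]cardsT -sum1_card big_distrl /= [leqRHS]big_mkcond.
apply: leq_sum => s _; rewrite mul1n.
have [s_heavy|] := boolP (s \in heavy m r).
  rewrite big1 // => j /andP[+ /eqP js]; by rewrite LE js s_heavy.
rewrite in_set -ltnNge in_setT => /ltnW; apply: leq_trans.
rewrite mulnC leq_mul2l sum1dep_card; apply/orP; right.
apply: subset_leq_card; apply/subsetP => j.
by rewrite in_set => /andP[_ js]; rewrite in_set.
Qed.

(** Words are sorted by their heavy set [T]. The indicator that [r] has heavy set [T] is majorised
    by a product over the letters of [r], so averaging over [r] gives an [n]-th power, whose base is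
    below 1 by [mass_lt]. *)
Lemma spectral_sum_bound : exists theta C : K,
  [/\ 0 < theta < 1, 0 < C & forall n, spectral_sum n <= C * theta ^+ n].
Proof.
have R0 := card_ring_gt0.
pose q (T : {set R}) : K := #|T|%:R * mass T / #|R|%:R.
pose t0 := \big[Num.max/0]_(T | T != [set: R]) q T.
have t0_ge0 : 0 <= t0 by exact: bigmax_ge_id.
have t0_lt1 : t0 < 1.
  by apply: bigmax_lt => // T TR; rewrite ltr_pdivrMr // mul1r mass_lt.
(* Penalty for a light letter, chosen with [#|R| * y = (1 - t0) / 2]: since masses are at most
   [#|R|], the penalised average over one letter stays below the midpoint [t1] of [t0] and 1. *)
pose y := (1 - t0) / (2 * #|R|%:R).
have y_gt0 : 0 < y by rewrite divr_gt0 ?subr_gt0 ?mulr_gt0.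
pose t1 := (1 + t0) / 2.
have t1E : t1 = t0 + #|R|%:R * y by rewrite /t1 /y; field; rewrite gt_eqF.
have t1_gt0 : 0 < t1 by rewrite /t1; lra.
have t1_lt1 : t1 < 1 by rewrite /t1; lra.
have R1 : 1 <= #|R|%:R :> K by rewrite ler1n -(ltr0n K).
have y_lt1 : y < 1 by rewrite /y ltr_pdivrMr ?mulr_gt0 // mul1r; lra.
(* [zz] lies strictly between [t1] and 1, so that dividing by it still leaves a ratio below 1; [m]
   is then taken large enough for [light_weight]. *)
pose zz := (1 + t1) / 2.
have zz_gt0 : 0 < zz by rewrite /zz; lra.
have zz_lt1 : zz < 1 by rewrite /zz; lra.
have t1_zz : t1 < zz by rewrite /zz; lra.
have [|m m_gt0 zzm] := @expr_small K zz (y ^+ #|R|) _ (exprn_gt0 _ y_gt0).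
  by rewrite zz_gt0.
have m0 : 0 < m%:R :> K by rewrite ltr0n.
(* Bernoulli's inequality turns this choice into [rho <= sigma ^+ m]. *)
pose sigma := 1 - (1 - rho) / m%:R.
have m1 : 1 <= m%:R :> K by rewrite ler1n.
have sigma_lt1 : sigma < 1 by rewrite /sigma gtrBl divr_gt0 ?subr_gt0.
have sm : (1 - rho) / m%:R <= 1.
  rewrite ler_pdivrMr // mul1r; apply: le_trans m1; by rewrite gerBl.
have sigma_ge0 : 0 <= sigma by rewrite subr_ge0.
have rho_sigma : rho <= sigma ^+ m.
  apply: le_trans (bernoulli m _); last by rewrite lerN2.
  by rewrite mulrN mulrC divfK ?gt_eqF // opprB addrCA subrr addr0.
have [|y1 [C1 [/andP[y1_gt0 y1_lt1] C1_gt0 hC1]]] := @linear_geometric K sigma.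
  by rewrite sigma_ge0.
(* [L] bounds [n.+1%:R * a] for every [n], with [a] as defined below, so that [(1 + a) ^+ n.+1]
   never exceeds [expR L]. *)
pose L := #|R|%:R * C1.
have L_gt0 : 0 < L by rewrite mulr_gt0.
(* [y1] is the rate for the words in which every letter is heavy, [t1 / zz] the rate for all
   others. *)
pose th := Num.max y1 (t1 / zz).
have th_ge1 : y1 <= th by rewrite le_max lexx.
have th_ge2 : t1 / zz <= th by rewrite le_max lexx orbT.
have th_gt0 : 0 < th by apply: lt_le_trans th_ge1.
have th_lt1 : th < 1 by rewrite gt_max y1_lt1 ltr_pdivrMr ?mul1r.
pose Cst := L * expR L + #|{set R}|%:R * (#|R|%:R * expR L).
exists th, Cst; split.
- by rewrite th_gt0.
- by rewrite ltr_pwDl ?mulr_gt0 ?expR_gt0 // mulr_ge0 // mulr_ge0 ?expR_ge0.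
move=> n; pose a := #|R|%:R * sigma ^+ n.
have a_ge0 : 0 <= a by rewrite mulr_ge0 ?exprn_ge0.
have Na : n.+1%:R * a <= L * y1 ^+ n.
  by rewrite mulrCA -mulrA ler_pM2l.
have NaL : n.+1%:R * a <= L.
  apply: le_trans Na _; rewrite ler_piMr ?(ltW L_gt0) // exprn_ile1 //; exact: ltW.
have powL : (1 + a) ^+ n.+1 <= expR (n.+1%:R * a).
  rewrite expRM_natl lerXn2r ?nnegrE ?expR_ge0 ?addr_ge0 //.
  exact: expR_ge1Dx.
have powL' : (1 + a) ^+ n.+1 <= expR L by apply: le_trans powL _; rewrite ler_expR.
pose h (T : {set R}) s : K := if s \in T then 1 else y.
pose b (r : {ffun 'I_n -> R}) (T : {set R}) : K :=
  #|R|%:R * expR L * \prod_j (mass T * h T (r j) / zz).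
have b_ge0 r T : 0 <= b r T.
  rewrite !mulr_ge0 ?expR_ge0 ?(ltW R0) //; apply: prodr_ge0 => j _.
  rewrite divr_ge0 ?(ltW zz_gt0) // mulr_ge0 //.
    exact: le_trans ler01 (mass_ge1 _).
  by rewrite /h; case: ifP; rewrite ?(ltW y_gt0).
have key r : twisted_mass r ^+ n.+1 - 1
    <= L * expR L * y1 ^+ n + \sum_(T | T != [set: R]) b r T.
  have g_le := @twisted_mass_le m n sigma r _ rho_sigma.
  have {g_le} g_le : twisted_mass r <= mass (heavy m r) + a.
    by apply: g_le; rewrite sigma_ge0 ltW.
  have g_ge0 := twisted_mass_ge0 r.
  (* If every letter is heavy, the mass is 1 and the bound is [(1 + a) ^+ n.+1 - 1]. Otherwise only
     the summand [T = heavy m r] is needed, the others being nonnegative. *)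
  have [hT|hT] := eqVneq (heavy m r) [set: R].
    apply: ler_wpDr; first by apply: sumr_ge0 => T _.
    apply: le_trans (_ : _ <= expR (n.+1%:R * a) - 1) _.
      rewrite lerD2r; apply: le_trans powL.
      by rewrite lerXn2r ?nnegrE ?addr_ge0 //; rewrite hT mass_setT in g_le.
    apply: le_trans (expR_sub1_le _) _; rewrite [leRHS]mulrAC.
    by apply: ler_pM; rewrite ?expR_ge0 ?ler_expR ?(mulr_ge0 (ler0n _ _) a_ge0).
  apply: ler_wpDl.
    exact: (mulr_ge0 (mulr_ge0 (ltW L_gt0) (expR_ge0 _)) (exprn_ge0 _ (ltW y1_gt0))).
  rewrite (bigD1 (heavy m r)) //=; apply: ler_wpDr; first by apply: sumr_ge0.
  set T := heavy m r in hT g_le *.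
  apply: le_trans (_ : _ <= twisted_mass r ^+ n.+1) _; first by rewrite gerBl.
  have M1 : 1 <= mass T := mass_ge1 T.
  have M0 : 0 < mass T by apply: lt_le_trans M1.
  apply: le_trans (_ : _ <= (mass T * (1 + a)) ^+ n.+1) _.
    rewrite lerXn2r ?nnegrE ?mulr_ge0 ?addr_ge0 ?(ltW M0) //.
    by apply: le_trans g_le _; rewrite mulrDr mulr1 lerD2l ler_peMl.
  have M0' := ltW M0; have a1_ge0 : 0 <= 1 + a by rewrite addr_ge0.
  (* One factor [mass T] is bounded by [#|R|]; the other [n] go into the product over letters, where
     [light_weight] shows that the factors [h T (r j) / zz] multiply to at least 1. *)
  rewrite exprMn mulrC [mass T ^+ n.+1]exprS /b [#|R|%:R * _]mulrC -[leRHS]mulrA.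
  apply: ler_pM => //; rewrite ?(exprn_ge0 _ a1_ge0) ?(mulr_ge0 M0' (exprn_ge0 n M0')) //.
  apply: ler_pM; rewrite ?exprn_ge0 ?(ltW M0) ?mass_le //.
  under eq_bigr do rewrite -mulrA; rewrite big_split prodr_const card_ord /=.
  rewrite ler_peMr ?exprn_ge0 ?(ltW M0) // big_split prodr_const card_ord /=.
  rewrite exprVn ler_pdivlMr ?exprn_gt0 // mul1r.
  have y01 : 0 <= y <= 1 by rewrite !ltW.
  exact: (light_weight r m_gt0 y01 (ltW zz_gt0) zzm).
rewrite spectral_sumE.
apply: le_trans (_ : #|R|%:R^-1 ^+ n * \sum_(r : {ffun 'I_n -> R})
   (L * expR L * y1 ^+ n + \sum_(T | T != [set: R]) b r T) <= _).
  by rewrite ler_wpM2l ?exprn_ge0 ?invr_ge0 ?(ltW R0) //; exact: ler_sum.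
rewrite big_split mulrDr /Cst mulrDl; apply: lerD.
  rewrite sumr_const card_ffun card_ord -[X in _ * X]mulr_natl natrX [leLHS]mulrA -exprMn.
  rewrite mulVf ?gt_eqF // expr1n mul1r.
  apply: ler_wpM2l; first exact: mulr_ge0 (ltW L_gt0) (expR_ge0 _).
  by rewrite lerXn2r ?nnegrE ?(ltW y1_gt0) ?(ltW th_gt0).
rewrite exchange_big mulr_sumr /=.
apply: le_trans (_ : \sum_(T | T != [set: R]) #|R|%:R * expR L * th ^+ n <= _); last first.
  rewrite sumr_const -[leLHS]mulr_natl mulrA ler_wpM2r ?exprn_ge0 ?(ltW th_gt0) //.
  by rewrite ler_wpM2r ?mulr_ge0 ?expR_ge0 ?(ltW R0) // ler_nat max_card.
apply: ler_sum => T TR; rewrite /b -mulr_sumr mulrCA.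
rewrite ler_wpM2l ?mulr_ge0 ?expR_ge0 ?(ltW R0) //.
rewrite -(exprn_sum n (fun s => mass T * h T s / zz)) -exprMn lerXn2r ?nnegrE //.
- rewrite mulr_ge0 ?invr_ge0 ?(ltW R0) // sumr_ge0 // => s _.
  rewrite divr_ge0 ?(ltW zz_gt0) // mulr_ge0 ?(le_trans ler01 (mass_ge1 _)) //.
  by rewrite /h; case: ifP; rewrite ?(ltW y_gt0).
- exact: ltW.
apply: le_trans th_ge2; rewrite -mulr_suml mulrA ler_pM2r ?invr_gt0 //.
rewrite -mulr_sumr /h (bigID (mem T)) /=.
rewrite (eq_bigr (fun=> 1)) => [|s ->//]; rewrite sumr_const.
rewrite [X in _ + X](eq_bigr (fun=> y)) => [|s /negPf->//].
rewrite mulrDr mulrDr t1E; apply: lerD.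
  apply: le_trans (_ : q T <= _); last by rewrite /t0 (le_bigmax_cond _ q).
  by rewrite /q mulrC [_%:R * _]mulrC.
rewrite sumr_const -[y *+ _]mulr_natl.
have cT : #|[predC T]|%:R <= #|R|%:R :> K by rewrite ler_nat max_card.
apply: le_trans (_ : #|R|%:R^-1 * (#|R|%:R * (#|R|%:R * y)) <= _); last first.
  by rewrite mulKf ?gt_eqF.
rewrite ler_pM2l ?invr_gt0 //; apply: ler_pM.
- exact: le_trans ler01 (mass_ge1 _).
- exact: mulr_ge0 (ler0n _ _) (ltW y_gt0).
- exact: mass_le.
- by rewrite ler_pM2r.
Qed.

(** * Replacing one column *)

Section Columns.
Variables (iota : {rmorphism K -> C}) (n : nat).
Hypothesis iota_le : {mono iota : x y / x <= y}.
Notation vec := {ffun 'I_n.+1 -> R}.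
Notation cols := {ffun 'I_n.+1 -> vec}.
Implicit Types (M : cols) (c : 'I_n.+1).

Definition is_prob (p : R -> K) : Prop := (forall x, 0 <= p x) /\ \sum_x p x = 1.

Definition fourier (p : R -> K) (chi : dual) : C := \sum_x iota (p x) * ev chi x.

Definition addcol c (y : vec) M : cols := [ffun b => if b == c then M b + y else M b].

Definition comb c (v : vec) M : vec := \sum_(b | b != c) scalev (v b) (M b).

Definition colw (p : R -> K) (x : vec) : K := \prod_a p (x a).

Definition restw (nu : 'I_n.+1 -> R -> K) c M : K :=
  \prod_(b | b != c) colw (nu b) (M b).

Lemma comb_addcol c v y M : comb c v (addcol c y M) = comb c v M.
Proof. by apply: eq_bigr => b bc; rewrite ffunE (negPf bc). Qed.

Lemma restw_addcol nu c y M : restw nu c (addcol c y M) = restw nu c M.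
Proof. by apply: eq_bigr => b bc; rewrite ffunE (negPf bc). Qed.

Lemma addcolE c y M : addcol c y M c = M c + y.
Proof. by rewrite ffunE eqxx. Qed.

Lemma addcolK c y M : addcol c (- y) (addcol c y M) = M.
Proof. by apply/ffunP => b; rewrite !ffunE; case: eqP => // _; rewrite addrK. Qed.

Lemma addcol_inj c y : injective (addcol c y).
Proof. exact: can_inj (addcolK c y). Qed.

Lemma addcol_comb_inj c v : injective (fun M => addcol c (comb c v M) M).
Proof.
move=> M M' e; rewrite -(addcolK c (comb c v M) M).
have ce : comb c v M = comb c v M'.
  by have := congr1 (comb c v) e; rewrite !comb_addcol.
by rewrite e ce addcolK.
Qed.

Lemma colw_sum1 p : is_prob p -> \sum_x colw p x = 1.
Proof.
move=> [_ p1]; rewrite -(bigA_distr_bigA (fun (a : 'I_n.+1) s => p s)).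
by apply: big1 => a _.
Qed.

Lemma colw_ge0 p x : is_prob p -> 0 <= colw p x.
Proof. by move=> [p0 _]; apply: prodr_ge0 => a _. Qed.

Lemma card_vec : #|vec|%:R = #|R|%:R ^+ n.+1 :> K.
Proof. by rewrite card_ffun card_ord natrX. Qed.

Lemma fourier_colw p (w : {ffun 'I_n.+1 -> dual}) :
  \sum_x iota (colw p x) * evw w x = \prod_a fourier p (w a).
Proof.
rewrite (bigA_distr_bigA (fun a s => iota (p s) * ev (w a) s)).
by apply: eq_bigr => x _; rewrite rmorph_prod -big_split.
Qed.

Lemma card_vec_gt0 : 0 < #|vec|%:R :> K.
Proof. by rewrite card_vec exprn_gt0 // card_ring_gt0. Qed.

(** The density at [x] of column [c], given the other columns, after a uniformly random combination
    of these has been added to it. *)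
Definition spread (p : R -> K) c M (x : vec) : K :=
  #|vec|%:R^-1 * \sum_v colw p (x - comb c v M).

(** For each [v], adding [comb c v M] to column [c] is a bijection of [cols] that fixes [H] and
    [restw]. The resulting identities are averaged over [v]. *)
Lemma sum_spread nu p c (H : cols -> K) :
  (forall v M, H (addcol c (comb c v M) M) = H M) ->
  \sum_M restw nu c M * colw p (M c) * H M
  = \sum_M restw nu c M * spread p c M (M c) * H M.
Proof.
move=> HE.
have shift v : \sum_M restw nu c M * colw p (M c - comb c v M) * H M
    = \sum_M restw nu c M * colw p (M c) * H M.
  rewrite (reindex_inj (@addcol_comb_inj c v)) /=; apply: eq_bigr => M _.
  by rewrite restw_addcol addcolE comb_addcol addrK HE.
transitivity (#|vec|%:R^-1 * \sum_(v : vec)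
    \sum_M restw nu c M * colw p (M c - comb c v M) * H M).
  rewrite [in RHS](eq_bigr _ (fun v _ => shift v)).
  by rewrite sumr_const -[X in _ * X]mulr_natl mulKf // gt_eqF ?card_vec_gt0.
rewrite exchange_big mulr_sumr; apply: eq_bigr => M _ /=.
by rewrite -mulr_suml -mulr_sumr mulrA mulrCA.
Qed.

Lemma sum_addcol c (g : cols -> K) :
  \sum_M g M = #|vec|%:R^-1 * \sum_M \sum_x g (addcol c x M).
Proof.
rewrite exchange_big /=.
rewrite [in RHS](eq_bigr (fun=> \sum_M g M)) => [|x _].
  by rewrite sumr_const -[X in _ * X]mulr_natl mulKf // gt_eqF ?card_vec_gt0.
by rewrite [RHS](reindex_inj (@addcol_inj c x)).
Qed.

Lemma sum_shift (f : vec -> K) (y : vec) : \sum_x f (y + x) = \sum_x f x.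
Proof. by rewrite [RHS](reindex_inj (addrI y)). Qed.

(** [restw] leaves column [c] free, so its total mass is [#|vec|]. *)
Lemma sum_restw nu c : (forall b, is_prob (nu b)) ->
  #|vec|%:R^-1 * \sum_M restw nu c M = 1.
Proof.
move=> hnu; rewrite mulr_sumr.
pose f b x : K := if b == c then #|vec|%:R^-1 else colw (nu b) x.
transitivity (\sum_(M : cols) \prod_b f b (M b)).
  apply: eq_bigr => M _; rewrite (bigD1 c) //= /f eqxx; congr (_ * _).
  by apply: eq_bigr => b /negPf ->.
rewrite -bigA_distr_bigA /= big1 // => b _; rewrite /f; case: (b == c).
  by rewrite sumr_const -[LHS]mulr_natl mulfV // gt_eqF ?card_vec_gt0.
exact: colw_sum1.
Qed.

(** By [comb_meanE] and [line_mean_bool] this is the indicator that [w] is trivial on all multiples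
    of every column other than [c]. *)
Definition comb_mean (w : {ffun 'I_n.+1 -> dual}) c M : C :=
  #|vec|%:R^-1 * \sum_v evw w (comb c v M).

Lemma comb_meanE w c M : comb_mean w c M = \prod_(b | b != c) line_mean w (M b).
Proof.
rewrite /comb_mean card_ffun card_ord natrX -exprVn.
pose f b s : C := #|R|%:R^-1 * (if b == c then 1 else evw w (scalev s (M b))).
transitivity (\sum_(v : vec) \prod_b f b (v b)).
  rewrite mulr_sumr; apply: eq_bigr => v _; rewrite /f big_split prodr_const card_ord.
  by rewrite evw_sum [X in _ = _ * X](bigD1 c) //= eqxx mul1r; congr (_ * _);
     apply: eq_bigr => b /negPf ->.
rewrite -bigA_distr_bigA (bigD1 c) //= -mulr_sumr eqxx.
have R_neq0 : #|R|%:R != 0 :> C by rewrite pnatr_eq0 -(pnatr_eq0 K) gt_eqF ?card_ring_gt0.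
rewrite sumr_const mulVf // mul1r.
by apply: eq_bigr => b /negPf bc; rewrite /f bc -mulr_sumr.
Qed.

Lemma card_vecC : #|vec|%:R = #|R|%:R ^+ n.+1 :> C.
Proof. by rewrite card_ffun card_ord natrX. Qed.

Lemma card_vecC_neq0 : #|vec|%:R != 0 :> C.
Proof. by rewrite pnatr_eq0 -(pnatr_eq0 K) gt_eqF ?card_vec_gt0. Qed.

Lemma iota_ge0 x : (0 <= iota x) = (0 <= x).
Proof. by rewrite -(rmorph0 iota) iota_le. Qed.

Lemma iota_sqr x : `|iota x| ^+ 2 = iota (x ^+ 2).
Proof.
rewrite rmorphXn real_normK // realE iota_ge0.
by rewrite -(rmorph0 iota) iota_le -realE num_real.
Qed.

Lemma fourier_trivial p : is_prob p -> fourier p trivial_char = 1.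
Proof.
move=> [_ p1]; rewrite -(rmorph1 iota) -p1 rmorph_sum.
by apply: eq_bigr => x _; rewrite ev_trivial mulr1.
Qed.

Lemma comb_mean_trivial c M : comb_mean (trivial_word n.+1) c M = 1.
Proof.
rewrite /comb_mean (eq_bigr (fun=> 1)) => [|v _]; last by rewrite evw_trivial.
by rewrite sumr_const mulVf // card_vecC_neq0.
Qed.

(** [spread] is the convolution of [colw p] with the law of the random combination, so its transform
    is a product. Subtracting the uniform density removes exactly the coefficient at the trivial
    word. *)
Lemma fourier_spread p c M w : is_prob p ->
  \sum_x iota (spread p c M x - #|vec|%:R^-1) * evw w x
  = if w == trivial_word n.+1 then 0
    else (\prod_a fourier p (w a)) * comb_mean w c M.
Proof.
move=> p_prob.
transitivity (\sum_x iota (spread p c M x) * evw w x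
              - #|vec|%:R^-1 * \sum_x evw w x).
  rewrite mulr_sumr -sumrB; apply: eq_bigr => x _.
  by rewrite rmorphB mulrBl fmorphV rmorph_nat.
have -> : \sum_x iota (spread p c M x) * evw w x
    = (\prod_a fourier p (w a)) * comb_mean w c M.
  rewrite -fourier_colw /comb_mean mulrCA.
  transitivity (\sum_(x : vec) \sum_(v : vec) #|vec|%:R^-1 *
      (iota (colw p (x - comb c v M)) * evw w x)).
    apply: eq_bigr => x _; rewrite rmorphM fmorphV rmorph_nat rmorph_sum.
    by rewrite -mulrA mulr_suml mulr_sumr.
  rewrite exchange_big mulr_sumr mulr_sumr; apply: eq_bigr => v _ /=.
  rewrite -mulr_sumr; congr (_ * _); rewrite mulr_suml.
  rewrite (reindex_inj (addIr (comb c v M))) /=; apply: eq_bigr => x _.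
  by rewrite addrK evwD mulrA.
rewrite sum_evw_vec; case: eqVneq => [->|_]; last by rewrite mulr0 subr0.
rewrite comb_mean_trivial mulr1 -card_vecC mulVf ?card_vecC_neq0 //.
rewrite big1 ?subrr // => a _; by rewrite ffunE fourier_trivial.
Qed.

Lemma comb_mean_sqr w c M : `|comb_mean w c M| ^+ 2 = comb_mean w c M.
Proof.
rewrite comb_meanE -normrX -prodrXl normr_prod; apply: eq_bigr => b _.
by have [[] ->] := line_mean_bool w (M b); rewrite ?expr1n ?expr0n ?normr1 ?normr0.
Qed.

Lemma energy_spread p c M : is_prob p ->
  iota (\sum_x (spread p c M x - #|vec|%:R^-1) ^+ 2)
  = #|vec|%:R^-1 * \sum_(w | w != trivial_word n.+1)
      (\prod_a `|fourier p (w a)| ^+ 2) * comb_mean w c M.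
Proof.
move=> p_prob; rewrite rmorph_sum.
transitivity (#|vec|%:R^-1 * (#|R|%:R ^+ n.+1 *
    \sum_x `|iota (spread p c M x - #|vec|%:R^-1)| ^+ 2)).
  rewrite -card_vecC mulKf ?card_vecC_neq0 //.
  by apply: eq_bigr => x _; rewrite iota_sqr.
rewrite -parseval; congr (_ * _); rewrite [RHS]big_mkcond.
apply: eq_bigr => w _; rewrite fourier_spread //; case: eqP => _ /=.
  by rewrite normr0 expr0n.
by rewrite normrM exprMn comb_mean_sqr normr_prod prodrXl.
Qed.

Lemma sum_colw_line p w :
  \sum_x iota (colw p x) * line_mean w x
  = #|R|%:R^-1 * \sum_s \prod_a fourier p (scale_char s (w a)).
Proof.
rewrite mulr_sumr.
transitivity (\sum_(x : vec) \sum_s #|R|%:R^-1 *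
    (iota (colw p x) * evw [ffun a => scale_char s (w a)] x)).
  apply: eq_bigr => x _; rewrite /line_mean mulrCA mulr_sumr mulr_sumr.
  by apply: eq_bigr => s _; rewrite evw_scale.
rewrite exchange_big; apply: eq_bigr => s _ /=.
rewrite -mulr_sumr fourier_colw; congr (_ * _).
by apply: eq_bigr => a _; rewrite ffunE.
Qed.

Lemma sum_restw_comb nu c w :
  #|vec|%:R^-1 * \sum_M iota (restw nu c M) * comb_mean w c M
  = \prod_(b | b != c)
      (#|R|%:R^-1 * \sum_s \prod_a fourier (nu b) (scale_char s (w a))).
Proof.
pose f b x : C := if b == c then #|vec|%:R^-1
                  else iota (colw (nu b) x) * line_mean w x.
transitivity (\sum_(M : cols) \prod_b f b (M b)).
  rewrite mulr_sumr; apply: eq_bigr => M _.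
  rewrite [RHS](bigD1 c) //= {1}/f eqxx; congr (_ * _).
  rewrite comb_meanE rmorph_prod -big_split; apply: eq_bigr => b /negPf bc.
  by rewrite /f bc.
rewrite -bigA_distr_bigA (bigD1 c) //= {1}/f eqxx.
rewrite sumr_const -[X in X * _]mulr_natl mulfV ?card_vecC_neq0 // mul1r.
by apply: eq_bigr => b /negPf bc; rewrite /f bc sum_colw_line.
Qed.

(** Invariance of [H] replaces the law of column [c] by [spread]. Jensen's inequality bounds the
    squared error by the averaged square deviation of [spread] from uniform, which [energy_spread]
    and the independence of the other columns express through Fourier coefficients. *)
Lemma column_step nu p c (H : cols -> K) :
  is_prob p -> (forall b, is_prob (nu b)) ->
  (forall chi, `|fourier p chi| <= iota (tau chi)) ->
  (forall b chi, `|fourier (nu b) chi| <= iota (tau chi)) ->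
  (forall v M, H (addcol c (comb c v M) M) = H M) ->
  (forall M, `|H M| <= 1) ->
  (\sum_M restw nu c M * (colw p (M c) - #|vec|%:R^-1) * H M) ^+ 2
  <= spectral_sum n.
Proof.
move=> p_prob nu_prob p_tau nu_tau H_inv H_le1.
have V0 := card_vec_gt0; set V := #|vec|%:R in V0 *.
pose dev M x := spread p c M x - V^-1.
have restw_ge0 M : 0 <= restw nu c M.
  by apply: prodr_ge0 => b _; exact: colw_ge0.
have -> : \sum_M restw nu c M * (colw p (M c) - V^-1) * H M
    = \sum_M restw nu c M * dev M (M c) * H M.
  transitivity (\sum_M restw nu c M * colw p (M c) * H M
                - \sum_M restw nu c M * V^-1 * H M).
    by rewrite -sumrB; apply: eq_bigr => M _; rewrite mulrBr mulrBl.
  rewrite sum_spread // -sumrB; apply: eq_bigr => M _.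
  by rewrite mulrBr mulrBl.
set E := \sum_M _.
have E_le : E ^+ 2 <= \sum_M restw nu c M * \sum_x dev M x ^+ 2.
  rewrite -[E ^+ 2]real_normK ?num_real //.
  apply: le_trans (_ : (\sum_M (V^-1 * restw nu c M) * (V * `|dev M (M c)|)) ^+ 2 <= _).
    rewrite lerXn2r ?nnegrE ?normr_ge0 //.
      apply: sumr_ge0 => M _.
      by rewrite mulr_ge0 // mulr_ge0 ?invr_ge0 ?(ltW V0).
    apply: le_trans (ler_norm_sum _ _ _) _; apply: ler_sum => M _.
    rewrite mulrACA mulVf ?gt_eqF // mul1r !normrM (ger0_norm (restw_ge0 M)).
    by rewrite ler_piMr // mulr_ge0.
  apply: le_trans (@jensen_sqr _ _ (fun M => V^-1 * restw nu c M)
    (fun M => V * `|dev M (M c)|) _ _) _ => [M||].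
  - by rewrite mulr_ge0 ?invr_ge0 ?(ltW V0).
  - by rewrite -mulr_sumr sum_restw.
  (* Column [c] is resampled: neither [restw] nor [spread] depends on it, so the deviation at [M c]
     turns into a sum over all vectors. *)
  rewrite (sum_addcol c) mulr_sumr; apply: ler_sum => M _.
  rewrite -(sum_shift (fun x => dev M x ^+ 2) (M c)) !mulr_sumr.
  apply: ler_sum => x _; rewrite restw_addcol addcolE /dev /spread.
  under eq_bigr do rewrite comb_addcol.
  rewrite exprMn real_normK ?num_real //.
  set d := _ - V^-1; rewrite le_eqVlt; apply/orP; left; apply/eqP; field; rewrite gt_eqF //.
apply: le_trans E_le _; rewrite -iota_le.
set T := \sum_M _; have T_ge0 : 0 <= iota T.
  rewrite iota_ge0; apply: sumr_ge0 => M _; rewrite mulr_ge0 //.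
  by apply: sumr_ge0 => x _; exact: sqr_ge0.
have TE : iota T = \sum_(w | w != trivial_word n.+1)
    (\prod_a `|fourier p (w a)| ^+ 2) * \prod_(b | b != c)
      (#|R|%:R^-1 * \sum_s \prod_a fourier (nu b) (scale_char s (w a))).
  rewrite /T rmorph_sum.
  transitivity (\sum_(M : cols) \sum_(w | w != trivial_word n.+1)
     (\prod_a `|fourier p (w a)| ^+ 2) *
       (#|vec|%:R^-1 * (iota (restw nu c M) * comb_mean w c M))).
    apply: eq_bigr => M _; rewrite rmorphM energy_spread // !mulr_sumr.
    by apply: eq_bigr => w _; ring.
  rewrite exchange_big; apply: eq_bigr => w _ /=.
  by rewrite -mulr_sumr -mulr_sumr sum_restw_comb.
rewrite -(ger0_norm T_ge0) TE; apply: le_trans (ler_norm_sum _ _ _) _.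
rewrite rmorph_sum; apply: ler_sum => w _; rewrite normrM rmorphM.
apply: ler_pM => //.
  rewrite normr_prod rmorph_prod; apply: ler_prod => a _.
  rewrite normr_ge0 normrX normr_id rmorphXn lerXn2r ?nnegrE //.
  by rewrite iota_ge0 tau_ge0.
rewrite normr_prod rmorphXn -[X in _ ^+ X](_ : #|[pred b : 'I_n.+1 | b != c]| = n).
  rewrite -prodr_const; apply: ler_prod => b _; rewrite normr_ge0 normrM.
  rewrite rmorphM fmorphV rmorph_nat ger0_norm ?invr_ge0 // ler_wpM2l ?invr_ge0 //.
  apply: le_trans (ler_norm_sum _ _ _) _; rewrite rmorph_sum; apply: ler_sum => s _.
  rewrite normr_prod rmorph_prod; apply: ler_prod => a _.
  by rewrite normr_ge0 nu_tau.
by rewrite cardC1 card_ord.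
Qed.

Definition unifp : R -> K := fun=> #|R|%:R^-1.

Lemma unifp_prob : is_prob unifp.
Proof.
split=> [x|]; first by rewrite invr_ge0 ler0n.
by rewrite sumr_const -[LHS]mulr_natl mulfV // gt_eqF // card_ring_gt0.
Qed.

Lemma fourier_unifp chi : `|fourier unifp chi| <= iota (tau chi).
Proof.
rewrite /fourier /unifp -mulr_sumr sum_ev_ring; case: eqP => [->|_]; last first.
  by rewrite mulr0 normr0 iota_ge0 tau_ge0.
rewrite fmorphV rmorph_nat mulVf ?normr1 ?tau_trivial ?rmorph1 //.
by rewrite pnatr_eq0 -(pnatr_eq0 K) gt_eqF // card_ring_gt0.
Qed.

Lemma hybrid_bound p (H : cols -> K) (delta : K) :
  is_prob p -> (forall chi, `|fourier p chi| <= iota (tau chi)) ->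
  (forall c v M, H (addcol c (comb c v M) M) = H M) ->
  (forall M, `|H M| <= 1) ->
  0 <= delta -> spectral_sum n <= delta ^+ 2 ->
  `|\sum_(M : cols) (\prod_b colw p (M b)) * H M
    - \sum_(M : cols) (\prod_b colw unifp (M b)) * H M| <= n.+1%:R * delta.
Proof.
move=> p_prob p_tau H_inv H_le1 delta_ge0 S_le.
(* Hybrid laws: the first [j] columns have law [p] and the rest are uniform, so consecutive hybrids
   differ in column [j] alone. *)
pose nu (j : nat) (b : 'I_n.+1) := if (b < j)%N then p else unifp.
pose E j := \sum_(M : cols) (\prod_b colw (nu j b) (M b)) * H M.
have nu_prob j b : is_prob (nu j b) by rewrite /nu; case: ifP => // _; exact: unifp_prob.
have nu_tau j b chi : `|fourier (nu j b) chi| <= iota (tau chi).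
  by rewrite /nu; case: ifP => // _; exact: fourier_unifp.
have step j : (j < n.+1)%N -> `|E j.+1 - E j| <= delta.
  move=> jn; pose c := Ordinal jn.
  rewrite -(@ler_pXn2r _ 2) ?nnegrE // real_normK ?num_real //.
  apply: le_trans S_le.
  apply: le_trans (@column_step (nu j) p c H p_prob (nu_prob j) p_tau (nu_tau j)
    (H_inv c) H_le1).
  rewrite /E -sumrB le_eqVlt; apply/orP; left; apply/eqP; congr (_ ^+ 2).
  apply: eq_bigr => M _; rewrite -mulrBl; congr (_ * _).
  rewrite (bigD1 c) //= [X in _ - X](bigD1 c) //= mulrBr mulrC; congr (_ * _ - _).
  - by apply: eq_bigr => b bc; rewrite /nu ltnS leq_eqVlt (negPf (bc : b != j :> nat)).
  - by rewrite /nu ltnSn.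
  - rewrite mulrC; congr (_ * _); rewrite /nu ltnn /colw /unifp prodr_const card_ord.
    by rewrite exprVn card_vec.
have -> : \sum_(M : cols) (\prod_b colw p (M b)) * H M = E n.+1.
  by apply: eq_bigr => M _; congr (_ * _); apply: eq_bigr => b _; rewrite /nu ltn_ord.
have -> : \sum_(M : cols) (\prod_b colw unifp (M b)) * H M = E 0%N by [].
rewrite -(telescope_sumr E) // big_mkord.
apply: le_trans (ler_norm_sum _ _ _) _.
apply: le_trans (_ : \sum_(j < n.+1) delta <= _).
  by apply: ler_sum => j _; exact: step.
by rewrite sumr_const card_ord mulr_natl.
Qed.

(** * Column operations as right multiplications, and bounds on Fourier coefficients *)

Definition mx_of_cols M : 'M[R]_n.+1 := \matrix_(a, b) M b a.

(** The entry at [(c, c)] is set to 0 whatever [v c] is. The matrix therefore squares to zero, and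
    [1%:M - elementary c v] inverts [1%:M + elementary c v]. *)
Definition elementary c (v : vec) : 'M[R]_n.+1 :=
  \matrix_(i, j) (if (j == c) && (i != c) then v i else 0).

Lemma elementary_sqr c v w : elementary c v *m elementary c w = 0.
Proof.
apply/matrixP => i j; rewrite !mxE big1 // => l _; rewrite !mxE.
by case: (eqVneq l c) => [->|_]; rewrite ?eqxx ?andbF ?mulr0 // mul0r.
Qed.

Lemma elementary_unit c v : 1%:M + elementary c v \in unitmx.
Proof.
apply: (@mulmx1_unit _ _ _ (1%:M - elementary c v) _).1.
rewrite mulmxDl mul1mx mulmxBr mulmx1 elementary_sqr subr0.
by rewrite subrK.
Qed.

Lemma mx_of_addcol c v M : mx_of_cols (addcol c (comb c v M) M)
  = mx_of_cols M *m (1%:M + elementary c v).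
Proof.
rewrite mulmxDr mulmx1; apply/matrixP => a b; rewrite !mxE ffunE.
case: eqVneq => [->|/negPf bc]; last first.
  by rewrite [X in _ + X]big1 ?addr0 // => l _; rewrite !mxE bc mulr0.
rewrite ffunE; congr (_ + _); rewrite sum_ffunE big_mkcond; apply: eq_bigr => l _.
rewrite !mxE eqxx /=; case: ifP => _; last by rewrite mulr0.
by rewrite ffunE mulrC.
Qed.

Lemma norm_fourier_sum p chi : is_prob p ->
  \sum_x `|iota (p x) * ev chi x| = 1.
Proof.
move=> [p0 p1]; rewrite -(rmorph1 iota) -p1 rmorph_sum; apply: eq_bigr => x _.
by rewrite normrM norm_ev mulr1 ger0_norm // iota_ge0.
Qed.

Lemma fourier_le1 p chi : is_prob p -> `|fourier p chi| <= 1.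
Proof. by move=> hp; rewrite -(norm_fourier_sum chi hp) ler_norm_sum. Qed.

(** Equality in the triangle inequality would align all the terms, making [chi] constant on the
    support of [p]. *)
Lemma fourier_lt1 p chi x y : is_prob p -> p x != 0 -> p y != 0 ->
  ev chi (x - y) != 1 -> `|fourier p chi| < 1.
Proof.
move=> hp px py; apply: contraR => h.
have /eqP f1 : `|fourier p chi| == 1.
  by have := fourier_le1 chi hp; rewrite le_eqVlt (negPf h) orbF.
have [|t t1 tE] := @normC_sum_eq C R xpredT (fun x => iota (p x) * ev chi x).
  by rewrite norm_fourier_sum.
have evE a : p a != 0 -> ev chi a = t.
  move=> pa; have := tE a isT; rewrite normrM norm_ev mulr1.
  rewrite ger0_norm ?iota_ge0 ?(proj1 hp) // => /mulfI -> //.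
  by rewrite fmorph_eq0.
rewrite evD evN !evE // mulfV //.
by rewrite -normr_eq0 (eqP t1) oner_eq0.
Qed.

End Columns.

End Weight.
End Dual.

(** * Products of random matrices *)

Section Expectation.
Variable K : realType.

Definition expect (T : finType) (P : fdist K T) (F : T -> K) : K :=
  \sum_x P x * F x.

Lemma expect_map (T U : finType) (f : T -> U) (P : fdist K T) F :
  expect (fdist_map f P) F = expect P (F \o f).
Proof.
rewrite /expect [RHS](partition_big f xpredT) //=; apply: eq_bigr => y _.
rewrite ffunE mulr_suml; apply: eq_bigr => x /eqP <-; by [].
Qed.

Lemma eq_expect (T : finType) (P : fdist K T) F G :
  F =1 G -> expect P F = expect P G.
Proof. by move=> FG; apply: eq_bigr => x _; rewrite FG. Qed.

Lemma expect_norm_le (T : finType) (P : fdist K T) F e :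
  (forall x, `|F x| <= e) -> `|expect P F| <= e.
Proof.
move=> F_le; apply: le_trans (ler_norm_sum _ _ _) _.
rewrite -[leRHS]mul1r -(fdist_sum1 P) mulr_suml; apply: ler_sum => x _.
by rewrite normrM (ger0_norm (fdist_ge0 P x)) ler_wpM2l ?fdist_ge0.
Qed.

Lemma expectB (T : finType) (P : fdist K T) F G :
  expect P F - expect P G = expect P (fun x => F x - G x).
Proof. by rewrite /expect -sumrB; apply: eq_bigr => x _; rewrite mulrBr. Qed.

Lemma expect_swap (T U : finType) (P : fdist K T) (Q : fdist K U) F :
  expect P (fun x => expect Q (F x)) = expect Q (fun y => expect P (F ^~ y)).
Proof.
rewrite /expect; under eq_bigr do rewrite mulr_sumr.
rewrite exchange_big; apply: eq_bigr => y _ /=.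
by rewrite mulr_sumr; apply: eq_bigr => x _; rewrite mulrCA.
Qed.

Lemma expect_pair (T U : finType) (P : fdist K T) (Q : fdist K U) F :
  expect (fdist_pair P Q) F = expect P (fun x => expect Q (fun y => F (x, y))).
Proof.
rewrite /expect; under [RHS]eq_bigr do rewrite mulr_sumr.
by rewrite pair_bigA; apply: eq_bigr => -[x y] _; rewrite ffunE /= mulrA.
Qed.

Lemma dTV_le (T : finType) (P Q : fdist K T) e : 0 <= e ->
  (forall h : T -> K, (forall x, `|h x| <= 1) ->
    `|expect P h - expect Q h| <= e) -> dTV P Q <= e.
Proof.
move=> e0 h_le; apply: bigmax_le => // E _.
have PrE (S : fdist K T) : Pr S E = expect S (fun x => (x \in E)%:R).
  rewrite /Pr big_mkcond; apply: eq_bigr => x _.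
  by case: (x \in E); rewrite ?mulr1 ?mulr0.
rewrite !PrE; apply: h_le => x; by case: (x \in E); rewrite ?normr1 ?normr0.
Qed.

End Expectation.

(** * Uniform and Haar-distributed matrices *)

Section Matrices.
Variables (K : realType) (R : finComUnitRingType).

Lemma expect_uniform (N : nat) (F : 'M[R]_N -> K) :
  expect (uniform_matrix K R N) F = #|{: 'M[R]_N}|%:R^-1 * \sum_m F m.
Proof.
rewrite /expect mulr_sumr; apply: eq_bigr => m _.
by rewrite ffunE inE cardsT mul1r.
Qed.

Lemma expect_uniform_mulr (N : nat) (g : 'M[R]_N) (F : 'M[R]_N -> K) :
  g \in unitmx ->
  expect (uniform_matrix K R N) (fun m => F (m *m g)) =
  expect (uniform_matrix K R N) F.
Proof.
move=> g_unit; rewrite !expect_uniform; congr (_ * _).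
rewrite [RHS](reindex_inj (h := fun m => m *m g)) //.
exact: can_inj (mulmxK g_unit).
Qed.

Lemma expect_uniform_mull (N : nat) (g : 'M[R]_N) (F : 'M[R]_N -> K) :
  g \in unitmx ->
  expect (uniform_matrix K R N) (fun m => F (g *m m)) =
  expect (uniform_matrix K R N) F.
Proof.
move=> g_unit; rewrite !expect_uniform; congr (_ * _).
rewrite [RHS](reindex_inj (h := mulmx g)) //.
exact: can_inj (mulKmx g_unit).
Qed.

Lemma expect_haar (N : nat) (F : 'M[R]_N -> K) :
  expect (haar_GL K R N) F =
  #|[set g : 'M[R]_N | g \in unitmx]|%:R^-1 * \sum_(g in unitmx) F g.
Proof.
rewrite /expect mulr_sumr [RHS]big_mkcond; apply: eq_bigr => m _.
by rewrite ffunE inE; case: (m \in unitmx); rewrite ?mul1r ?mul0r.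
Qed.

Lemma expect_haar_mull (N : nat) (e : 'M[R]_N) (F : 'M[R]_N -> K) :
  e \in unitmx ->
  expect (haar_GL K R N) (fun g => F (e *m g)) = expect (haar_GL K R N) F.
Proof.
move=> e_unit; rewrite !expect_haar; congr (_ * _).
rewrite [RHS](reindex_inj (h := mulmx e)) /=; last exact: can_inj (mulKmx e_unit).
by apply: eq_bigl => g; rewrite unitmx_mul e_unit.
Qed.

Lemma expect_haar_const (N : nat) (F : 'M[R]_N -> K) (a : K) :
  (forall g, g \in unitmx -> F g = a) -> expect (haar_GL K R N) F = a.
Proof.
move=> Fa; transitivity (expect (haar_GL K R N) (fun=> a)).
  by rewrite !expect_haar; congr (_ * _); apply: eq_bigr => g; exact: Fa.
by rewrite /expect -mulr_suml fdist_sum1 mul1r.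
Qed.

Lemma fdist_is_prob (xi : fdist K R) : is_prob xi.
Proof. by split; [exact: fdist_ge0 | exact: fdist_sum1]. Qed.

Lemma mx_of_cols_bij n : bijective (@mx_of_cols R n).
Proof.
exists (fun m : 'M[R]_n.+1 => [ffun b => [ffun a => m a b]]) => [M|m].
  by apply/ffunP => b; apply/ffunP => a; rewrite !ffunE mxE.
by apply/matrixP => a b; rewrite mxE !ffunE.
Qed.

Lemma expect_iid n (xi : fdist K R) (F : 'M[R]_n.+1 -> K) :
  expect (iid_matrix n.+1 xi) F =
  \sum_(M : {ffun 'I_n.+1 -> {ffun 'I_n.+1 -> R}})
    (\prod_b colw xi (M b)) * F (mx_of_cols M).
Proof.
rewrite expect_map /expect.
pose f (M : {ffun 'I_n.+1 -> {ffun 'I_n.+1 -> R}}) :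
    {ffun 'I_n.+1 * 'I_n.+1 -> R} := [ffun ij => M ij.2 ij.1].
rewrite (reindex f) /=; last first.
  exists (fun x : {ffun 'I_n.+1 * 'I_n.+1 -> R} => [ffun b => [ffun a => x (a, b)]]).
    by move=> M _; apply/ffunP => b; apply/ffunP => a; rewrite !ffunE.
  by move=> x _; apply/ffunP => -[a b]; rewrite !ffunE.
apply: eq_bigr => M _; rewrite ffunE; congr (_ * F _).
  rewrite exchange_big pair_bigA; apply: eq_bigr => -[a b] _.
  by rewrite ffunE.
by apply/matrixP => a b; rewrite !mxE ffunE.
Qed.

Lemma sum_cols_unifp n (F : 'M[R]_n.+1 -> K) :
  \sum_(M : {ffun 'I_n.+1 -> {ffun 'I_n.+1 -> R}})
    (\prod_b colw (@unifp R K) (M b)) * F (mx_of_cols M)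
  = expect (uniform_matrix K R n.+1) F.
Proof.
rewrite expect_uniform mulr_sumr [RHS](reindex _ (onW_bij _ (mx_of_cols_bij n))) /=.
apply: eq_bigr => M _; congr (_ * _).
rewrite /colw /unifp prodr_const prodr_const card_ord -exprM.
by rewrite card_mx natrX exprVn.
Qed.

End Matrices.

(** * Induction on the number of factors *)

Section Products.
Variables (K : realType) (R : finComUnitRingType) (N : nat).
Notation mx := 'M[R]_N.
Implicit Types (P : fdist K mx) (h : mx -> K).

Definition haar_mean (h : mx -> K) (m : mx) : K :=
  expect (haar_GL K R N) (fun g => h (m *m g)).

Definition expect_prod k (P : 'I_k -> fdist K mx) (h : mx -> K) : K :=
  expect (fdist_prod P) (fun x : {ffun 'I_k -> mx} => h (\prod_i x i)).

Lemma expect_law_MG k (xi : 'I_k -> fdist K R) h :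
  expect (law_MG N xi) h = expect_prod (fun i => iid_matrix N (xi i)) (haar_mean h).
Proof. by rewrite expect_map expect_pair. Qed.

Lemma expect_law_U k h :
  expect (law_U K R N k) h = expect_prod (fun _ : 'I_k => uniform_matrix K R N) h.
Proof. by rewrite expect_map. Qed.

Lemma expect_prod_recr k (P : 'I_k.+1 -> fdist K mx) h :
  expect_prod P h = expect_prod (fun i => P (widen_ord (leqnSn k) i))
    (fun m => expect (P ord_max) (fun t => h (m *m t))).
Proof.
pose snoc (xt : {ffun 'I_k -> mx} * mx) : {ffun 'I_k.+1 -> mx} :=
  [ffun i => oapp xt.1 xt.2 (unlift ord_max i)].
have snoc_widen xt i : snoc xt (widen_ord (leqnSn k) i) = xt.1 i.
  rewrite ffunE (_ : widen_ord _ i = lift ord_max i) ?liftK //.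
  by apply: val_inj; rewrite /= /bump leqNgt ltn_ord.
have snoc_max xt : snoc xt ord_max = xt.2 by rewrite ffunE unlift_none.
rewrite /expect_prod /expect (reindex snoc) /=; last first.
  exists (fun x : {ffun 'I_k.+1 -> mx} =>
    ([ffun i => x (widen_ord (leqnSn k) i)], x ord_max)) => [[x t]|x] _.
    by congr pair; rewrite ?snoc_max //; apply/ffunP => i; rewrite ffunE snoc_widen.
  apply/ffunP => i; case: (unliftP ord_max i) => [j|] ->; last by rewrite snoc_max.
  rewrite (_ : lift ord_max j = widen_ord (leqnSn k) j) ?snoc_widen ?ffunE //.
  by apply: val_inj; rewrite /= /bump leqNgt ltn_ord.
under [RHS]eq_bigr do rewrite mulr_sumr.
rewrite pair_bigA; apply: eq_bigr => -[x t] _ /=.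
rewrite !ffunE !big_ord_recr /= snoc_max mulrA.
congr (_ * _ * h _); first by apply: eq_bigr => i _; rewrite snoc_widen.
by rewrite -mulmxE; congr (_ *m _); apply: eq_bigr => i _; rewrite snoc_widen.
Qed.

Lemma expect_prod0 (P : 'I_0 -> fdist K mx) h : expect_prod P h = h 1%R.
Proof.
rewrite -[RHS]mul1r -(fdist_sum1 (fdist_prod P)) mulr_suml.
by apply: eq_bigr => x _; rewrite big_ord0.
Qed.

Lemma eq_expect_prod k (P : 'I_k -> fdist K mx) h1 h2 :
  h1 =1 h2 -> expect_prod P h1 = expect_prod P h2.
Proof. by move=> h12; apply: eq_expect => x; exact: h12. Qed.

(** An invertible matrix times a uniform one is again uniform. *)
Lemma haar_mean_uniform h m :
  haar_mean (fun m' => expect (uniform_matrix K R N) (fun t => h (m' *m t))) m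
  = expect (uniform_matrix K R N) (fun t => h (m *m t)).
Proof.
apply: expect_haar_const => g g_unit.
rewrite -(expect_uniform_mull (fun t => h (m *m t)) g_unit).
by apply: eq_expect => t; rewrite mulmxA.
Qed.

(* By induction on the number of factors: once [M_k G] has been replaced by a
   uniform matrix, the latter absorbs a fresh Haar factor on its left. *)
Lemma expect_prod_uniform k (P : 'I_k.+1 -> fdist K mx) (e : K) h :
  (forall i h', (forall m, `|h' m| <= 1) ->
    `|expect (P i) (haar_mean h') - expect (uniform_matrix K R N) h'| <= e) ->
  (forall m, `|h m| <= 1) ->
  `|expect_prod P (haar_mean h)
    - expect_prod (fun _ : 'I_k.+1 => uniform_matrix K R N) h| <= k.+1%:R * e.
Proof.
elim: k P h => [|k IHk] P h P_close h_le1.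
  rewrite !expect_prod_recr !expect_prod0 mul1r.
  have hE : h =1 (fun t => h (1 *m t)) by move=> t; rewrite mul1mx.
  have := P_close ord_max _ h_le1; congr (`|_ - _| <= _).
    by apply: eq_expect => t; apply: eq_expect => g; rewrite mul1mx.
  exact: eq_expect.
rewrite [X in `|X - _|]expect_prod_recr [X in `|_ - X|]expect_prod_recr.
set P' := fun i => P _.
pose h' m := expect (uniform_matrix K R N) (fun t => h (m *m t)).
have h'_le1 m : `|h' m| <= 1 by apply: expect_norm_le.
(* In the intermediate quantity the last factor is uniform and the earlier ones still have their
   laws. The function [h'] equals its own Haar mean, so the induction hypothesis applies to it. *)
rewrite -(subrKA (expect_prod P' h')) -natr1 mulrDl mul1r addrC.
apply: le_trans (ler_normD _ _) _; apply: lerD.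
  rewrite -(eq_expect_prod P' (haar_mean_uniform h)).
  by apply: IHk => // i g g_le1; exact: P_close.
rewrite expectB; apply: expect_norm_le => x.
set m := \prod_i x i.
have := P_close ord_max (fun t => h (m *m t)) (fun t => h_le1 _).
congr (`|_ - _| <= _); apply: eq_expect => t; apply: eq_expect => g.
by rewrite mulmxA.
Qed.

End Products.

(** Applies [hybrid_bound] to the Haar mean of [h], which is invariant under the column operations
    because these multiply on the right by invertible matrices. *)
Lemma single_matrix (K : realType) (R : finComUnitRingType) (xi : fdist K R) :
  (exists x y : R,
     [/\ x \in fsupp xi, y \in fsupp xi & x - y \is a GRing.unit]) ->
  (forall (S : {set R}) (u b : R),
     subring_closed S -> S \proper [set: R] ->
     ~~ (fsupp xi \subset affine_translate S u b)) ->
  exists theta A : K, [/\ 0 < theta < 1, 0 < A &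
    forall n (h : 'M[R]_n.+1 -> K), (forall m, `|h m| <= 1) ->
      `|expect (iid_matrix n.+1 xi) (haar_mean h)
        - expect (uniform_matrix K R n.+1) h| <= A * theta ^+ n].
Proof.
move=> [x0 [y0 [x0_supp y0_supp u_unit]]] not_affine.
have card_gt0 : (0 < #|R|)%N by apply/card_gt0P; exists 0.
have [z z_prim] := prim_root_exists K[i] card_gt0.
pose iota : {rmorphism K -> K[i]} := real_complex K.
have iota_le : {mono iota : x y / x <= y} by move=> x y; exact: lecR.
pose abs (x : K[i]) := complex.Re `|x|.
have absE x : iota (abs x) = `|x| by exact: (RRe_real (normr_real x)).
pose D := [set x - y | x in fsupp xi, y in fsupp xi].
have xi_prob := fdist_is_prob xi.
pose coef (chi : dual R z) : K := abs (fourier iota xi chi).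
pose rho := \big[Num.max/0]_(chi | chi \notin annihilator z D) coef chi.
have rho_ge0 : 0 <= rho by exact: bigmax_ge_id.
have rho_lt1 : rho < 1.
  apply: bigmax_lt => // chi; rewrite inE => /forall_inPn[d /imset2P[x y px py ->] chi_xy].
  rewrite !inE in px py.
  rewrite -(leW_mono iota_le) absE rmorph1.
  exact: (fourier_lt1 z_prim iota_le xi_prob px py chi_xy).
have xi_tau (chi : dual R z) : `|fourier iota xi chi| <= iota (tau D rho chi).
  rewrite /tau; case: ifPn => hchi.
    by rewrite rmorph1; exact: (fourier_le1 z_prim iota_le chi xi_prob).
  by rewrite -absE iota_le; exact: le_bigmax_cond.
have uD : x0 - y0 \in D by apply/imset2P; exists x0 y0.
(* If all differences lay in [(x0 - y0) * S], the support would lie in the affine translate of [S]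
   based at [y0]. *)
have D_gen (S : {set R}) : subring_closed S ->
    (forall d, d \in D -> exists2 s, s \in S & d = (x0 - y0) * s) -> S = [set: R].
  move=> S_ring hS; apply/eqP; apply: contraT => S_proper.
  have := not_affine S (x0 - y0) y0 S_ring; rewrite properT => /(_ S_proper).
  suff -> : fsupp xi \subset affine_translate S (x0 - y0) y0 by [].
  apply/subsetP => x x_supp.
  have [|s sS xE] := hS (x - y0); first by apply/imset2P; exists x y0.
  by apply/imsetP; exists s; rewrite // -xE subrK.
have [th [A [/andP[th_gt0 th_lt1] A_gt0 S_le]]] :=
  spectral_sum_bound z_prim uD u_unit D_gen rho_ge0 rho_lt1.
(* Each of the [n.+1] column exchanges costs the square root of the spectral sum; a rate slightly
   above [Num.sqrt th] absorbs the factor [n.+1]. *)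
have [|th' [A' [th'01 A'_gt0 geo]]] := @linear_geometric K (Num.sqrt th).
  rewrite sqrtr_ge0 /= -[ltRHS]sqrtr1 ltr_sqrt //.
exists th', (Num.sqrt A * A'); split; rewrite ?mulr_gt0 ?sqrtr_gt0 // => n h h_le1.
pose delta := Num.sqrt A * Num.sqrt th ^+ n.
apply: le_trans (_ : n.+1%:R * delta <= _); last first.
  by rewrite mulrCA -mulrA ler_wpM2l ?sqrtr_ge0.
have delta_ge0 : 0 <= delta by rewrite mulr_ge0 ?exprn_ge0 ?sqrtr_ge0.
have S_delta : spectral_sum z_prim D rho n <= delta ^+ 2.
  rewrite exprMn exprAC (sqr_sqrtr (ltW A_gt0)) (sqr_sqrtr (ltW th_gt0)).
  exact: S_le.
rewrite expect_iid.
rewrite (_ : expect _ h = expect (uniform_matrix K R n.+1) (haar_mean h)).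
  rewrite -(sum_cols_unifp (haar_mean h)).
  apply: (hybrid_bound rho_ge0 iota_le) xi_prob xi_tau _ _ delta_ge0 S_delta.
    move=> c v M; rewrite mx_of_addcol /haar_mean.
    rewrite -[RHS](expect_haar_mull _ (elementary_unit c v)).
    by apply: eq_expect => g; rewrite mulmxA.
  by move=> M; apply: expect_norm_le.
rewrite /haar_mean expect_swap; symmetry; apply: expect_haar_const => g g_unit.
exact: expect_uniform_mulr.
Qed.

Theorem mainTheorem1 (K : realType) (R : finComUnitRingType) (k : nat)
  (xi : 'I_k -> fdist K R) :
  local_ring R -> (1 <= k)%N ->
  (forall i : 'I_k, exists x y : R,
     [/\ x \in fsupp (xi i), y \in fsupp (xi i) & x - y \is a GRing.unit]) ->
  (forall (i : 'I_k) (S : {set R}) (u b : R),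
     subring_closed S -> S \proper [set: R] ->
     ~~ (fsupp (xi i) \subset affine_translate S u b)) ->
  exists c C : K, [/\ 0 < c, 0 < C &
    forall N : nat, (1 <= N)%N ->
      dTV (law_MG N xi) (law_U K R N k) <= C * expR (- c * N%:R)].
Proof.
case: k xi => [//|k] xi _ _ xi_unit xi_affine.
have /fin_all_exists[th /fin_all_exists[C thC]] i :=
  single_matrix (xi_unit i) (xi_affine i).
pose t := \big[Num.max/0]_i th i; pose Ct := \sum_i C i.
have t_ge i : th i <= t by exact: le_bigmax_cond.
have t_lt1 : t < 1.
  by apply: bigmax_lt => // i _; have [/andP[_ ->]] := thC i.
have t_ge0 : 0 <= t by exact: bigmax_ge_id.
have C_ge0 i : 0 <= C i by have [_ /ltW] := thC i.
have Ct_gt0 : 0 < Ct.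
  rewrite /Ct (bigD1 ord0) //= ltr_pwDl ?sumr_ge0 //.
  by have [_ ->] := thC ord0.
(* The inequality [t = 1 - c <= expR (- c)] converts the geometric rate. The extra factor [expR c]
   in the constant makes up for the exponent [n] where [N = n.+1]. *)
pose c := 1 - t; have c_gt0 : 0 < c by rewrite subr_gt0.
exists c, (k.+1%:R * Ct * expR c); split=> // [|[//|n] _].
  by rewrite !mulr_gt0 ?expR_gt0.
have e_ge0 : 0 <= Ct * t ^+ n by rewrite mulr_ge0 ?exprn_ge0 // ltW.
apply: le_trans (_ : _ <= k.+1%:R * (Ct * t ^+ n)) _.
  apply: dTV_le => [|h h_le1]; first by rewrite mulr_ge0.
  rewrite expect_law_MG expect_law_U; apply: expect_prod_uniform => // i h' h'_le1.
  have [/andP[/ltW thi_ge0 _] _ /(_ n h' h'_le1)] := thC i.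
  move=> /le_trans; apply; apply: ler_pM; rewrite ?exprn_ge0 //.
    by rewrite /Ct (bigD1 i) //= lerDl sumr_ge0.
  by rewrite lerXn2r ?nnegrE.
rewrite -!mulrA ler_wpM2l // ler_wpM2l ?(ltW Ct_gt0) // -expRD.
apply: le_trans (_ : expR (- c) ^+ n <= _).
  rewrite lerXn2r ?nnegrE ?expR_ge0 //; apply: le_trans (expR_ge1Dx _).
  by rewrite /c opprB addrCA subrr addr0.
by rewrite -expRM_natl ler_expR -natr1; lra.
Qed.
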